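(* Let $X'$ be a simplicial complex with subcomplexes $X'_0\le\dots\le X'_n=X'$ such that $|X'|$ is a PL stratified pseudomanifold of dimension $n$ with stratification $|X'_0|\subset\dots\subset|X'_n|=|X'|$. Let $X=Sd^2(X')$, let $\mathcal{T}$ be the topology on $X$ with base $\{\mathrm{fst}(\sigma)\mid\sigma\in X'\}$, and let $\bar p$ be a Goresky–MacPherson perversity. Then $F\in D_\Delta(\mathcal{T})$ satisfies the $\Delta$-Deligne axioms if and only if $$F\simeq\tau_{\le\bar p(n)}R(\iota_n)_*\cdots\tau_{\le\bar p(2)}R(\iota_2)_*\,\mathbb{R}_{U_2^\Delta}$$ in $D_\Delta(\mathcal{T})$.
   Context: Simplicial complexes are abstract: a complex $K$ is a vertex set $V(K)$ and a set of nonempty finite subsets (simplices) containing all singletons and closed under nonempty subsets; $K$ also denotes its set of simplices. $Y\le K$ means $Y$ is a subcomplex; $\sigma<\tau$ means $\sigma\subset\tau$ (equality allowed). $Sd(K)$ is the barycentric subdivision: vertices are the simplices of $K$, simplices are nonempty finite chains $\sigma_0\subset\dots\subset\sigma_m$. For $Y,Z\le K$, $Y-_\Delta Z=\{\sigma\in Y\mid\sigma\cap V(Z)=\emptyset\}$. PL stratified pseudomanifold of dimension $n$: a PL space $P$ (Hausdorff, second countable, with locally finite triangulations) with a filtration by closed PL subspaces $\emptyset=P_{-1}\subset P_0\subset\dots\subset P_{n-2}=P_{n-1}\subset P_n=P$ such that each $P_k-P_{k-1}$ is empty or a $k$-manifold, $P-P_{n-2}$ is dense, and each point of $P_k-P_{k-1}$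 has a neighborhood PL homeomorphic, compatibly with filtrations, to $\mathbb{R}^k\times cL$, with $L$ a compact PL stratified pseudomanifold of dimension $n-k-1$ and $cL$ its open cone. A Goresky–MacPherson perversity is $\bar p:\{2,3,\dots\}\to\mathbb{Z}$ with $\bar p(2)=0$ and $\bar p(k)\le\bar p(k+1)\le\bar p(k)+1$. For $\sigma\in X'$, $b_\sigma=\{\{\sigma\}\}$ is the barycenter of $\sigma$, regarded as a vertex of $X=Sd^2(X')$; $\mathrm{lst}(\sigma)$ is the (closed) star of this vertex in $X$ (the subcomplex of all faces of simplices of $X$ containing it), and $\mathrm{fst}(\sigma)=\bigcup_{\tau\in X',\,\sigma<\tau}\mathrm{lst}(\tau)$. The open sets of $\mathcal{T}$ are the unions of sets $\mathrm{fst}(\sigma)$; they are subcomplexes of $X$, and the points of the space $(X,\mathcal{T})$ are the simplices of $X$. Write $X_k=Sd^2(X'_k)$, $X_{-1}=\emptyset$, and $U_k^\Delta=X-_\Delta X_{n-k}$ for $2\le k\le n+1$ (so $U^\Delta_{n+1}=X$); these are open in $\mathcal{T}$, and $\iota_k:U_k^\Delta\hookrightarrow U_{k+1}^\Delta$ is the inclusion. $D_\Delta(\mathcal{T})$ is the (bounded below) derived category of sheaves of real vector spaces on $(X,\mathcal{T})$, and similarly for its open subspaces $U_k^\Delta$; $\tau_{\le j}$ is the usual truncation, and $\mathbb{R}_{U}$ is the constant sheaf in degree $0$. $F\in D_\Delta(\mathcal{T})$ satisfies the $\Delta$-Deligne axioms if (AX 1) $F|_{U_2^\Delta}\simeq\mathbb{R}_{U_2^\Delta}$;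 (AX 2) $F|_{U_{k+1}^\Delta}\simeq\tau_{\le\bar p(k)}R(\iota_k)_*(F|_{U_k^\Delta})$ for all $k\in\{2,\dots,n\}$. *)

(* Defs.v *)
From HB Require Import structures.
From mathcomp Require Import all_boot all_order all_algebra finmap.
From mathcomp Require Import all_classical reals topology normedtype.

Set Implicit Arguments.
Unset Strict Implicit.
Unset Printing Implicit Defensive.

Import Order.TTheory GRing.Theory Num.Theory.
Import numFieldNormedType.Exports.

Local Open Scope classical_set_scope.
Local Open Scope ring_scope.

(* The vertex set is not a separate field: since every vertex spans a simplex,
   it is recovered as [vertices]. *)
Record scomplex (T : choiceType) := SComplex {
  simplices :> set {fset T};
  simplex_neq0 : forall s, simplices s -> s != fset0;
  simplex_face : forall s t, simplices s -> t != fset0 -> (t `<=` s)%fset ->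
    simplices t }.

Definition vertices (T : choiceType) (K : scomplex T) : set T :=
  [set v | simplices K [fset v]%fset].

Definition subcomplex (T : choiceType) (Y Z : scomplex T) := Y `<=` Z.

Lemma empty_complex_neq0 (T : choiceType) (s : {fset T}) :
  set0 s -> s != fset0.
Proof. by []. Qed.

Lemma empty_complex_face (T : choiceType) (s t : {fset T}) :
  set0 s -> t != fset0 -> (t `<=` s)%fset -> set0 t.
Proof. by []. Qed.

Definition empty_complex (T : choiceType) : scomplex T :=
  SComplex (@empty_complex_neq0 T) (@empty_complex_face T).

Definition chain_of (T : choiceType) (K : scomplex T) : set {fset {fset T}} :=
  [set c | [/\ c != fset0, (forall s, s \in c -> simplices K s) &
    forall s t, s \in c -> t \in c -> (s `<=` t)%fset || (t `<=` s)%fset]].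

Lemma chain_neq0 (T : choiceType) (K : scomplex T) c :
  chain_of K c -> c != fset0.
Proof. by case. Qed.

Lemma chain_face (T : choiceType) (K : scomplex T) c d :
  chain_of K c -> d != fset0 -> (d `<=` c)%fset -> chain_of K d.
Proof.
move=> [_ Kc cc] d0 /fsubsetP dc; split=> // [s /dc /Kc //|s t /dc sc /dc tc].
exact: cc.
Qed.

Definition Sd (T : choiceType) (K : scomplex T) : scomplex {fset T} :=
  SComplex (@chain_neq0 T K) (@chain_face T K).

(* Y -_Delta Z *)
Definition sdiff (T : choiceType) (Y Z : scomplex T) : set {fset T} :=
  [set s | simplices Y s /\ forall v, v \in s -> ~ vertices Z v].

Definition barycenter (T : choiceType) (s : {fset T}) :
  {fset {fset {fset T}}} := [fset [fset s]]%fset.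

(* The closed star lst(s): as a vertex of Sd (Sd K), the barycenter of s is
   the simplex [fset s] of Sd K. *)
Definition lstar (T : choiceType) (K : scomplex T) (s : {fset T}) :
    set {fset {fset {fset T}}} :=
  [set c | simplices (Sd (Sd K)) c /\
    exists d, [/\ simplices (Sd (Sd K)) d, (barycenter s `<=` d)%fset & (c `<=` d)%fset]].

Definition fstar (T : choiceType) (K : scomplex T) (s : {fset T}) :
    set {fset {fset {fset T}}} :=
  \bigcup_(t in [set t | simplices K t /\ (s `<=` t)%fset]) lstar K t.

Definition fst_space (T : choiceType) (K : scomplex T) : Type :=
  set_type (Sd (Sd K)).

HB.instance Definition _ (T : choiceType) (K : scomplex T) :=
  Choice.on (fst_space K).

(* A set of simplices of X, as a set of points of (X, T). *)
Definition points (T : choiceType) (K : scomplex T)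
    (A : set {fset {fset {fset T}}}) : set (fst_space K) :=
  [set c | A (val c)].
Arguments points {T} K A.

Section FstTopology.
Context (T : choiceType) (K : scomplex T).

Lemma lstarP (s : {fset T}) (c : {fset {fset {fset T}}}) : simplices K s ->
  simplices (Sd (Sd K)) c -> lstar K s c <-> forall x, x \in c -> s \in x.
Proof.
move=> Ks Xc; split.
  move=> [_ [d [[_ dK dd] bd /fsubsetP cd]]] x xc.
  have sd : [fset s]%fset \in d.
    by move/fsubsetP: bd; apply; rewrite /barycenter inE.
  have [x0 xK xx] := dK _ (cd _ xc).
  case/orP: (dd _ _ sd (cd _ xc)) => [/fsubsetP|xs].
    by apply; rewrite inE.
  have /fset0Pn[y yx] := x0.
  by have := fsubsetP xs _ yx; rewrite inE => /eqP <-.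
move=> cs; split=> //.
have [c0 cK cc] := Xc.
exists ([fset s]%fset |` c)%fset; split; last exact: fsubsetU1.
- split; first by apply/fset0Pn; exists [fset s]%fset; rewrite !inE eqxx.
    move=> x; rewrite in_fset1U => /orP[/eqP->|/cK //]; split.
    + by apply/fset0Pn; exists s; rewrite inE.
    + by move=> y; rewrite inE => /eqP->.
    + by move=> y z; rewrite !inE => /eqP-> /eqP->; rewrite fsubset_refl.
  move=> x y; rewrite !in_fset1U => /orP[/eqP->|xc] /orP[/eqP->|yc].
  + by rewrite fsubset_refl.
  + by rewrite fsub1set cs.
  + by rewrite [X in _ || X]fsub1set cs ?orbT.
  + exact: cc.
- by rewrite /barycenter fsub1set !inE eqxx.
Qed.

Lemma Sd2_min (c : {fset {fset {fset T}}}) : simplices (Sd (Sd K)) c ->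
  exists2 x, x \in c & forall y, y \in c -> (x `<=` y)%fset.
Proof.
move=> [c0 _ cc].
have /fset0Pn[x0 x0c] := c0.
have [x xc xmin] : exists2 x, x \in c & forall y, y \in c ->
    (#|` x| <= #|` y|)%N.
  have := @arg_minnP c [` x0c]%fset predT (fun x => #|` val x|) isT.
  case=> x _ xmin; exists (val x); first exact: fsvalP.
  by move=> y yc; exact: (xmin [` yc]%fset isT).
exists x => // y yc; case/orP: (cc _ _ xc yc) => // yx.
by have /eqP-> : y == x by rewrite eqEfcard yx xmin.
Qed.

Lemma fst_cover : \bigcup_(s in K) points K (fstar K s) = setT.
Proof.
apply/seteqP; split=> // c _.
have Xc : simplices (Sd (Sd K)) (val c) by have := valP c; rewrite inE.
have [x xc xmin] := Sd2_min Xc.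
have [_ /(_ _ xc)[/fset0Pn[s sx] xK _] _] := Xc.
have Ks : simplices K s := xK _ sx.
exists s => //; exists s; first by split=> //; exact: fsubset_refl.
by apply/lstarP => // y /xmin /fsubsetP; apply.
Qed.

Lemma fst_join s t (c : fst_space K) : simplices K s -> simplices K t ->
  points K (fstar K s) c -> points K (fstar K t) c ->
  exists u, [/\ simplices K u, points K (fstar K u) c &
    points K (fstar K u) `<=` points K (fstar K s) `&` points K (fstar K t)].
Proof.
move=> Ks Kt [s' [Ks' ss'] cs'] [t' [Kt' tt'] ct'].
have Xc : simplices (Sd (Sd K)) (val c) by have := valP c; rewrite inE.
have [x xc xmin] := Sd2_min Xc.
have [_ /(_ _ xc)[_ _ xx] _] := Xc.
have s'x := (lstarP Ks' Xc).1 cs' _ xc.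
have t'x := (lstarP Kt' Xc).1 ct' _ xc.
have sub u : simplices K u -> (s `<=` u)%fset -> (t `<=` u)%fset ->
    points K (fstar K u) `<=` points K (fstar K s) `&` points K (fstar K t).
  move=> Ku su tu d [v [Kv uv] dv].
  by split; exists v => //; split=> //; apply: fsubset_trans uv.
case/orP: (xx _ _ s'x t'x) => st.
- exists t'; split=> //.
    by exists t' => //; split=> //; exact: fsubset_refl.
  by apply: sub => //; exact: fsubset_trans st.
- exists s'; split=> //.
    by exists s' => //; split=> //; exact: fsubset_refl.
  by apply: sub => //; exact: fsubset_trans st.
Qed.

End FstTopology.

HB.instance Definition _ (T : choiceType) (K : scomplex T) :=
  isBaseTopological.Build (fst_space K) (@fst_cover T K) (@fst_join T K).

Lemma fst_openP (T : choiceType) (K : scomplex T) (A : set (fst_space K)) :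
  open A <-> exists2 S, S `<=` K & \bigcup_(s in S) points K (fstar K s) = A.
Proof. by []. Qed.

(* X'_0 <= ... <= X'_n = X'; the values [stage k] for k > n play no role. *)
Record filtration (T : choiceType) (K : scomplex T) (n : nat) := Filtration {
  stage : nat -> scomplex T;
  stage_le : forall k, (k < n)%N -> subcomplex (stage k) (stage k.+1);
  stage_top : stage n = K }.

(* X'_j for an integer index, with X'_j empty for j < 0. *)
Definition skel (T : choiceType) (K : scomplex T) (n : nat)
    (F : filtration K n) (j : int) : scomplex T :=
  if j is Posz k then stage F k else empty_complex T.

Record opens (T : topologicalType) := Opens {
  opens_set :> set T;
  opens_open : open opens_set }.

Record subopen (T : topologicalType) (U : opens T) := SubOpen {
  subopen_set :> set T;
  subopen_open : open subopen_set;
  subopen_sub : subopen_set `<=` U }.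

Definition full_opens (T : topologicalType) : opens T := Opens (@openT T).

Section StrataOpen.
Context (T : choiceType) (K : scomplex T) (n : nat) (F : filtration K n).

(* U_k = X -_Delta X_(n-k) *)
Definition Udelta_set (k : nat) : set (fst_space K) :=
  points K (sdiff (Sd (Sd K)) (Sd (Sd (skel F (n%:Z - k%:Z))))).

Lemma Udelta_open k : open (Udelta_set k).
Proof.
rewrite /Udelta_set; set Y := skel F _.
apply/fst_openP.
exists (simplices K `&` ~` simplices Y); first by move=> s [].
apply/seteqP; split=> c.
  move=> [s [Ks nYs] [t [Kt st] ct]].
  have Xc : simplices (Sd (Sd K)) (val c) by have := valP c; rewrite inE.
  split=> // x xc [_ /(_ x (fset11 x)) [_ Yx _] _].
  apply: nYs; apply: (simplex_face (Yx t _)) => //.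
    exact: (lstarP Kt Xc).1 ct _ xc.
  exact: simplex_neq0 Ks.
move=> [Xc ncY]; have [x xc xmin] := Sd2_min Xc.
have [_ /(_ _ xc)[x0 xK xx] _] := Xc.
have [s sx nYs] : exists2 s, s \in x & ~ simplices Y s.
  apply: contrapT => nex; apply: (ncY _ xc); split.
  - by apply/fset0Pn; exists x; rewrite inE.
  - move=> y; rewrite inE => /eqP->; split=> // s sx.
    by apply: contrapT => nYs; apply: nex; exists s.
  - by move=> y z; rewrite !inE => /eqP-> /eqP->; rewrite fsubset_refl.
have Ks := xK _ sx.
exists s; first by split.
exists s; first by split=> //; exact: fsubset_refl.
by apply/lstarP => // y /xmin /fsubsetP; apply.
Qed.

Definition Udelta (k : nat) : opens (fst_space K) := Opens (Udelta_open k).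

Lemma Udelta_le k : Udelta k `<=` Udelta k.+1.
Proof.
move=> c [Xc ncY]; split=> // x xc [x0 xY xx].
apply: (ncY _ xc); split=> // y yx; have [y0 yY yy] := xY _ yx.
split=> // s /yY; rewrite /skel.
have [kn|nk] := ltnP k n.
  rewrite !subzn // ?(ltnW kn) //= subnS => Fs.
  have nk0 : (0 < n - k)%N by rewrite subn_gt0.
  by have := @stage_le _ _ _ F (n - k).-1; rewrite prednK // leq_subr => /(_ isT); apply.
have -> : n%:Z - k.+1%:Z = Negz (k - n).
  by rewrite NegzE -subSn // -subzn ?opprB // leqW.
by [].
Qed.

Lemma Udelta_top k : (n < k)%N -> full_opens (fst_space K) `<=` Udelta k.
Proof.
move=> nk c _; split; first by have := valP c; rewrite inE.
move=> x xc [_ /(_ x (fset11 x)) [x0 xY _] _].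
have /fset0Pn[s /xY] := x0; rewrite /skel.
have -> : n%:Z - k%:Z = Negz (k - n.+1).
  by rewrite NegzE -subSn // subSS -subzn ?opprB // ltnW.
by [].
Qed.

End StrataOpen.

Section Subopens.
Context (T : topologicalType).

Lemma subopenI_open (U : opens T) (V W : subopen U) : open (V `&` W).
Proof. by apply: openI; apply: subopen_open. Qed.

Lemma subopenI_sub (U : opens T) (V W : subopen U) : V `&` W `<=` U.
Proof. by move=> x [/subopen_sub]. Qed.

Definition subopenI (U : opens T) (V W : subopen U) : subopen U :=
  SubOpen (@subopenI_open U V W) (@subopenI_sub U V W).

Definition widen (U U' : opens T) (h : U `<=` U') (V : subopen U) :
  subopen U' := SubOpen (@subopen_open _ _ V) (subset_trans (@subopen_sub _ _ V) h).

Lemma trace_open (U U' : opens T) (V : subopen U') : open (V `&` U).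
Proof. by apply: openI; [apply: subopen_open | apply: opens_open]. Qed.

Definition trace (U U' : opens T) (V : subopen U') : subopen U :=
  SubOpen (@trace_open U U' V) (@subIsetr _ V U).

Lemma trace_le (U U' : opens T) (V W : subopen U') :
  W `<=` V -> trace U W `<=` trace U V.
Proof. by move=> h; apply: setSI. Qed.

End Subopens.

(* Open subsets of the open subspace U are the open subsets of T contained in
   U, so a sheaf on U is a sheaf on the poset [subopen U]. *)
Record sheaf (R : realType) (T : topologicalType) (U : opens T) := Sheaf {
  sec :> subopen U -> lmodType R;
  res : forall V W : subopen U, W `<=` V -> {linear sec V -> sec W};
  res_id : forall (V : subopen U) (h : V `<=` V) (s : sec V), res h s = s;
  res_comp : forall (V W Z : subopen U)
    (h : W `<=` V) (h' : Z `<=` W) (h'' : Z `<=` V) (s : sec V),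
    res h' (res h s) = res h'' s;
  sheaf_sep : forall (V : subopen U) (J : Type) (W : J -> subopen U)
    (c : forall j, W j `<=` V), V `<=` \bigcup_j W j ->
    forall s t : sec V, (forall j, res (c j) s = res (c j) t) -> s = t;
  sheaf_glue : forall (V : subopen U) (J : Type) (W : J -> subopen U)
    (c : forall j, W j `<=` V), V `<=` \bigcup_j W j ->
    forall s : forall j, sec (W j),
    (forall i j, res (@subIsetl _ (W i) (W j) : subopenI (W i) (W j) `<=` W i) (s i)
               = res (@subIsetr _ (W i) (W j) : subopenI (W i) (W j) `<=` W j) (s j)) ->
    exists t : sec V, forall j, res (c j) t = s j }.

Record hom (R : realType) (T : topologicalType) (U : opens T)
    (F G : sheaf R U) := Hom {
  hom_map :> forall V : subopen U, {linear F V -> G V};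
  hom_nat : forall (V W : subopen U) (h : W `<=` V) (s : F V),
    hom_map W (res _ h s) = res _ h (hom_map V s) }.

Section SheafCategory.
Context (R : realType) (T : topologicalType) (U : opens T).
Implicit Types F G H : sheaf R U.

Lemma id_hom_nat F (V W : subopen U) (h : W `<=` V) (s : F V) :
  [the {linear F W -> F W} of idfun] (res _ h s) =
  res _ h ([the {linear F V -> F V} of idfun] s).
Proof. by []. Qed.

Definition id_hom F : hom F F := Hom (@id_hom_nat F).

Lemma zero_hom_nat F G (V W : subopen U) (h : W `<=` V) (s : F V) :
  [the {linear F W -> G W} of \0] (res _ h s) =
  res _ h ([the {linear F V -> G V} of \0] s).
Proof. by rewrite /= linear0. Qed.

Definition zero_hom F G : hom F G := Hom (@zero_hom_nat F G).

Lemma comp_hom_nat F G H (g : hom G H) (f : hom F G)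
    (V W : subopen U) (h : W `<=` V) (s : F V) :
  [the {linear F W -> H W} of g W \o f W] (res _ h s) =
  res _ h ([the {linear F V -> H V} of g V \o f V] s).
Proof. by rewrite /= !hom_nat. Qed.

Definition comp_hom F G H (g : hom G H) (f : hom F G) : hom F H :=
  Hom (@comp_hom_nat F G H g f).

Definition injective_sheaf (J : sheaf R U) : Prop :=
  forall (F G : sheaf R U) (m : hom F G) (f : hom F J),
    (forall V : subopen U, injective (m V)) ->
    exists g : hom G J, forall (V : subopen U) (s : F V), g V (m V s) = f V s.

Definition is_zero_sheaf F : Prop := forall (V : subopen U) (s : F V), s = 0.

End SheafCategory.

Section Submodule.
Context (R : realType) (V : lmodType R) (P : set V).

Definition is_submodule : Prop :=
  P 0 /\ forall a x y, P x -> P y -> P (a *: x + y).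

Definition submod_pred (_ : is_submodule) : {pred V} := [pred x | `[< P x >]].

Context (HP : is_submodule).

Lemma submod_pred_closed : submod_closed (submod_pred HP).
Proof.
split; first by apply/asboolP; exact: HP.1.
by move=> a x y /asboolP Px /asboolP Py; apply/asboolP; exact: HP.2.
Qed.

HB.instance Definition _ :=
  GRing.isSubmodClosed.Build R V (submod_pred HP) submod_pred_closed.

Definition submodule := {x : V | x \in submod_pred HP}.

HB.instance Definition _ := SubChoice.on submodule.
HB.instance Definition _ := [SubChoice_isSubLmodule of submodule by <:].

Lemma submoduleP (x : submodule) : P (val x).
Proof. by have /asboolP := valP x. Qed.

Definition to_submodule (x : V) (Px : P x) : submodule := exist _ x (asboolT Px).

End Submodule.

Record local_condition (R : realType) (T : topologicalType) (U : opens T)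
    (F : sheaf R U) := LocalCondition {
  cond :> forall V : subopen U, set (F V);
  cond_submodule : forall V : subopen U, is_submodule (@cond V);
  cond_res : forall (V W : subopen U) (h : W `<=` V) (s : F V),
    cond s -> cond (res _ h s);
  cond_local : forall (V : subopen U) (J : Type) (W : J -> subopen U)
    (c : forall j, W j `<=` V), V `<=` \bigcup_j W j ->
    forall s : F V, (forall j, cond (res _ (c j) s)) -> cond s }.
Arguments cond {R T U F} l V _.

Section Subsheaf.
Context (R : realType) (T : topologicalType) (U : opens T).
Context (F : sheaf R U) (P : local_condition F).

Definition subsheaf_sec (V : subopen U) : lmodType R :=
  submodule (cond_submodule P V).

Section Res.
Context (V W : subopen U) (h : W `<=` V).

Definition subsheaf_res_fun (s : subsheaf_sec V) : subsheaf_sec W :=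
  to_submodule (cond_submodule P W) (cond_res h (submoduleP s)).

Lemma subsheaf_res_linear : linear subsheaf_res_fun.
Proof. by move=> a x y; apply: val_inj; rewrite /= !linearP. Qed.

HB.instance Definition _ := GRing.isLinear.Build R (subsheaf_sec V)
  (subsheaf_sec W) *:%R subsheaf_res_fun subsheaf_res_linear.

Definition subsheaf_res : {linear subsheaf_sec V -> subsheaf_sec W} :=
  subsheaf_res_fun.

End Res.

Lemma subsheaf_res_id (V : subopen U) (h : V `<=` V) (s : subsheaf_sec V) :
  subsheaf_res h s = s.
Proof. by apply: val_inj; rewrite /= res_id. Qed.

Lemma subsheaf_res_comp (V W Z : subopen U) (h : W `<=` V) (h' : Z `<=` W)
    (h'' : Z `<=` V) (s : subsheaf_sec V) :
  subsheaf_res h' (subsheaf_res h s) = subsheaf_res h'' s.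
Proof. by apply: val_inj; rewrite /= (res_comp h h' h''). Qed.

Lemma subsheaf_sep (V : subopen U) (J : Type) (W : J -> subopen U)
    (c : forall j, W j `<=` V) : V `<=` \bigcup_j W j ->
  forall s t : subsheaf_sec V,
    (forall j, subsheaf_res (c j) s = subsheaf_res (c j) t) -> s = t.
Proof.
move=> cov s t st; apply: val_inj; apply: (sheaf_sep cov (c := c)) => j.
by have := congr1 val (st j).
Qed.

Lemma subsheaf_glue (V : subopen U) (J : Type) (W : J -> subopen U)
    (c : forall j, W j `<=` V) : V `<=` \bigcup_j W j ->
  forall s : forall j, subsheaf_sec (W j),
  (forall i j,
    subsheaf_res (@subIsetl _ (W i) (W j) : subopenI (W i) (W j) `<=` W i) (s i) =
    subsheaf_res (@subIsetr _ (W i) (W j) : subopenI (W i) (W j) `<=` W j) (s j)) ->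
  exists t : subsheaf_sec V, forall j, subsheaf_res (c j) t = s j.
Proof.
move=> cov s comp.
have [|t tP] := sheaf_glue c cov (s := fun j => val (s j)).
  by move=> i j; have := congr1 val (comp i j).
have Pt : P V t by apply: (cond_local cov (c := c)) => j; rewrite tP; exact: submoduleP.
by exists (to_submodule (cond_submodule P V) Pt) => j; apply: val_inj; rewrite /= tP.
Qed.

Definition subsheaf : sheaf R U :=
  Sheaf subsheaf_res_id subsheaf_res_comp subsheaf_sep subsheaf_glue.

End Subsheaf.

Section Subhom.
Context (R : realType) (T : topologicalType) (U : opens T).
Context (F G : sheaf R U) (P : local_condition F) (Q : local_condition G).
Context (f : hom F G) (PQ : forall V (s : F V), P V s -> Q V (f V s)).

Section Map.
Context (V : subopen U).

Definition subhom_fun (s : subsheaf P V) : subsheaf Q V :=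
  to_submodule (cond_submodule Q V) (PQ (submoduleP s)).

Lemma subhom_linear : linear subhom_fun.
Proof. by move=> a x y; apply: val_inj; rewrite /= !linearP. Qed.

HB.instance Definition _ := GRing.isLinear.Build R (subsheaf P V)
  (subsheaf Q V) *:%R subhom_fun subhom_linear.

Definition subhom_map : {linear subsheaf P V -> subsheaf Q V} := subhom_fun.

End Map.

Lemma subhom_nat (V W : subopen U) (h : W `<=` V) (s : subsheaf P V) :
  subhom_map W (res _ h s) = res _ h (subhom_map V s).
Proof. by apply: val_inj; rewrite /= hom_nat. Qed.

Definition subhom : hom (subsheaf P) (subsheaf Q) := Hom subhom_nat.

End Subhom.

Section Restrict.
Context (R : realType) (T : topologicalType) (U U' : opens T).
Context (h : U `<=` U').

Section Sheaf.
Context (F : sheaf R U').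

Definition restrict_sec (V : subopen U) : lmodType R := F (widen h V).

Definition restrict_res (V W : subopen U) (k : W `<=` V) :
  {linear restrict_sec V -> restrict_sec W} :=
  @res _ _ _ F (widen h V) (widen h W) k.

Lemma restrict_res_id (V : subopen U) (k : V `<=` V) (s : restrict_sec V) :
  restrict_res k s = s.
Proof. exact: res_id. Qed.

Lemma restrict_res_comp (V W Z : subopen U) (k : W `<=` V) (k' : Z `<=` W)
    (k'' : Z `<=` V) (s : restrict_sec V) :
  restrict_res k' (restrict_res k s) = restrict_res k'' s.
Proof. exact: res_comp. Qed.

Lemma restrict_sep (V : subopen U) (J : Type) (W : J -> subopen U)
    (c : forall j, W j `<=` V) : V `<=` \bigcup_j W j ->
  forall s t : restrict_sec V,
    (forall j, restrict_res (c j) s = restrict_res (c j) t) -> s = t.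
Proof.
move=> cov s t.
exact: (@sheaf_sep _ _ _ F (widen h V) J (fun j => widen h (W j)) c cov s t).
Qed.

Lemma restrict_glue (V : subopen U) (J : Type) (W : J -> subopen U)
    (c : forall j, W j `<=` V) : V `<=` \bigcup_j W j ->
  forall s : forall j, restrict_sec (W j),
  (forall i j,
    restrict_res (@subIsetl _ (W i) (W j) : subopenI (W i) (W j) `<=` W i) (s i) =
    restrict_res (@subIsetr _ (W i) (W j) : subopenI (W i) (W j) `<=` W j) (s j)) ->
  exists t : restrict_sec V, forall j, restrict_res (c j) t = s j.
Proof.
move=> cov s comp.
apply: (@sheaf_glue _ _ _ F (widen h V) J (fun j => widen h (W j)) c cov s).
move=> i j.
pose A := widen h (subopenI (W i) (W j)).
pose B := subopenI (widen h (W i)) (widen h (W j)).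
have BA : B `<=` A by [].
have li : A `<=` widen h (W i) by move=> x [].
have lj : A `<=` widen h (W j) by move=> x [].
refine (etrans (esym (@res_comp _ _ _ F (widen h (W i)) A B li BA (@subIsetl _ _ _) (s i))) _).
refine (etrans _ (@res_comp _ _ _ F (widen h (W j)) A B lj BA (@subIsetr _ _ _) (s j))).
by rewrite (Prop_irrelevance li (@subIsetl _ (W i) (W j)))
  (Prop_irrelevance lj (@subIsetr _ (W i) (W j))); congr (res _ _ _); exact: comp.
Qed.

Definition restrict_sheaf : sheaf R U :=
  Sheaf restrict_res_id restrict_res_comp restrict_sep restrict_glue.

End Sheaf.

Definition restrict_hom (F G : sheaf R U') (f : hom F G) :
  hom (restrict_sheaf F) (restrict_sheaf G) :=
  @Hom _ _ _ (restrict_sheaf F) (restrict_sheaf G) (fun V => f (widen h V))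
    (fun V W k s => @hom_nat _ _ _ _ _ f (widen h V) (widen h W) k s).

End Restrict.

(* (i_* F)(V) = F(V `&` U) for the inclusion i of U in U'. *)
Section Push.
Context (R : realType) (T : topologicalType) (U U' : opens T).

Section Sheaf.
Context (F : sheaf R U).

Definition push_sec (V : subopen U') : lmodType R := F (trace U V).

Definition push_res (V W : subopen U') (k : W `<=` V) :
  {linear push_sec V -> push_sec W} := res F (trace_le (U := U) k).

Lemma push_res_id (V : subopen U') (k : V `<=` V) (s : push_sec V) :
  push_res k s = s.
Proof. exact: res_id. Qed.

Lemma push_res_comp (V W Z : subopen U') (k : W `<=` V) (k' : Z `<=` W)
    (k'' : Z `<=` V) (s : push_sec V) :
  push_res k' (push_res k s) = push_res k'' s.
Proof. exact: res_comp. Qed.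

Lemma trace_cover (V : subopen U') (J : Type) (W : J -> subopen U') :
  V `<=` \bigcup_j W j -> trace U V `<=` \bigcup_j trace U (W j).
Proof. by move=> cov x [/cov [j _ Wx] Ux]; exists j. Qed.

Lemma push_sep (V : subopen U') (J : Type) (W : J -> subopen U')
    (c : forall j, W j `<=` V) : V `<=` \bigcup_j W j ->
  forall s t : push_sec V,
    (forall j, push_res (c j) s = push_res (c j) t) -> s = t.
Proof.
move=> /trace_cover cov s t.
exact: (@sheaf_sep _ _ _ F (trace U V) J (fun j => trace U (W j))
  (fun j => trace_le (U := U) (c j)) cov s t).
Qed.

Lemma push_glue (V : subopen U') (J : Type) (W : J -> subopen U')
    (c : forall j, W j `<=` V) : V `<=` \bigcup_j W j ->
  forall s : forall j, push_sec (W j),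
  (forall i j,
    push_res (@subIsetl _ (W i) (W j) : subopenI (W i) (W j) `<=` W i) (s i) =
    push_res (@subIsetr _ (W i) (W j) : subopenI (W i) (W j) `<=` W j) (s j)) ->
  exists t : push_sec V, forall j, push_res (c j) t = s j.
Proof.
move=> /trace_cover cov s comp.
apply: (@sheaf_glue _ _ _ F (trace U V) J (fun j => trace U (W j))
  (fun j => trace_le (U := U) (c j)) cov s) => i j.
pose A := trace U (subopenI (W i) (W j)).
pose B := subopenI (trace U (W i)) (trace U (W j)).
have BA : B `<=` A by move=> x [[]] ? ? [].
refine (etrans (esym (@res_comp _ _ _ F (trace U (W i)) A B
  (@trace_le _ U _ (W i) (subopenI (W i) (W j)) (@subIsetl _ _ _)) BA (@subIsetl _ _ _) (s i))) _).
refine (etrans _ (@res_comp _ _ _ F (trace U (W j)) A B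
  (@trace_le _ U _ (W j) (subopenI (W i) (W j)) (@subIsetr _ _ _)) BA (@subIsetr _ _ _) (s j))).
by congr (res _ _ _); exact: comp.
Qed.

Definition push_sheaf : sheaf R U' :=
  Sheaf push_res_id push_res_comp push_sep push_glue.

End Sheaf.

Definition push_hom (F G : sheaf R U) (f : hom F G) :
  hom (push_sheaf F) (push_sheaf G) :=
  @Hom _ _ _ (push_sheaf F) (push_sheaf G) (fun V => f (trace U V))
    (fun V W k s => hom_nat f (trace_le (U := U) k) s).

End Push.

Section ConstantSheaf.
Context (R : realType) (T : topologicalType) (U : opens T).

Definition fun_sec (V : subopen U) : lmodType R := {x : T | subopen_set V x} -> R.

Lemma fun_sec_irr (V : subopen U) (s : fun_sec V) x p q :
  s (exist _ x p) = s (exist _ x q).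
Proof. by congr s; exact: eq_exist. Qed.

Section Res.
Context (V W : subopen U) (h : W `<=` V).

Definition fun_res_fun (s : fun_sec V) : fun_sec W :=
  fun x => s (exist _ (sval x) (h (proj2_sig x))).

Lemma fun_res_linear : linear fun_res_fun.
Proof. by []. Qed.

HB.instance Definition _ := GRing.isLinear.Build R (fun_sec V)
  (fun_sec W) *:%R fun_res_fun fun_res_linear.

Definition fun_res : {linear fun_sec V -> fun_sec W} := fun_res_fun.

End Res.

Lemma fun_res_id (V : subopen U) (k : V `<=` V) (s : fun_sec V) :
  fun_res k s = s.
Proof.
by apply/funext => -[x Vx]; rewrite /= /fun_res_fun /=; congr s; exact: eq_exist.
Qed.

Lemma fun_res_comp (V W Z : subopen U) (k : W `<=` V) (k' : Z `<=` W)
    (k'' : Z `<=` V) (s : fun_sec V) :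
  fun_res k' (fun_res k s) = fun_res k'' s.
Proof.
by apply/funext => -[x Vx]; rewrite /= /fun_res_fun /=; congr s; exact: eq_exist.
Qed.

Lemma fun_sep (V : subopen U) (J : Type) (W : J -> subopen U)
    (c : forall j, W j `<=` V) : V `<=` \bigcup_j W j ->
  forall s t : fun_sec V,
    (forall j, fun_res (c j) s = fun_res (c j) t) -> s = t.
Proof.
move=> cov s t st; apply/funext => -[x Vx]; have [j _ Wx] := cov _ Vx.
rewrite (fun_sec_irr s Vx (c j x Wx)) (fun_sec_irr t Vx (c j x Wx)).
have e := congr1 (fun g : fun_sec (W j) => g (exist _ x Wx)) (st j).
rewrite /= /fun_res_fun in e. exact e.
Qed.

Lemma fun_glue (V : subopen U) (J : Type) (W : J -> subopen U)
    (c : forall j, W j `<=` V) : V `<=` \bigcup_j W j ->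
  forall s : forall j, fun_sec (W j),
  (forall i j,
    fun_res (@subIsetl _ (W i) (W j) : subopenI (W i) (W j) `<=` W i) (s i) =
    fun_res (@subIsetr _ (W i) (W j) : subopenI (W i) (W j) `<=` W j) (s j)) ->
  exists t : fun_sec V, forall j, fun_res (c j) t = s j.
Proof.
move=> cov s comp.
have pick (x : {x : T | subopen_set V x}) : {j | subopen_set (W j) (sval x)}.
  by apply: cid; have [j _ Wx] := cov _ (svalP x); exists j.
exists (fun x => s (sval (pick x)) (exist _ (sval x) (svalP (pick x)))) => j.
apply/funext => -[x Wx]; rewrite /= /fun_res_fun /=.
case: (pick _) => i /= Wix.
have e := congr1 (fun g : fun_sec (subopenI (W i) (W j)) =>
  g (exist _ x (conj Wix Wx))) (comp i j).
refine (etrans (fun_sec_irr (s i) _ _) (etrans e (fun_sec_irr (s j) _ _))).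
Qed.

Definition fun_sheaf : sheaf R U :=
  Sheaf fun_res_id fun_res_comp fun_sep fun_glue.

Definition locally_constant (V : subopen U) : set (fun_sheaf V) :=
  [set s | forall x : {x : T | subopen_set V x}, exists W : subopen U,
    subopen_set W (sval x) /\ forall y : {x : T | subopen_set V x}, subopen_set W (sval y) -> s y = s x].

Lemma locally_constant_submodule V : is_submodule (@locally_constant V).
Proof.
split; first by move=> x; exists V; split=> //; exact: svalP.
move=> a s t sl tl x; have [W [Wx sW]] := sl x; have [Z [Zx tZ]] := tl x.
exists (subopenI W Z); split=> // y [Wy Zy].
by rewrite /= !fctE sW ?tZ.
Qed.

Lemma locally_constant_res (V W : subopen U) (h : W `<=` V) (s : fun_sheaf V) :
  locally_constant s -> locally_constant (res _ h s).
Proof.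
move=> sl x; have [Z [Zx sZ]] := sl (exist _ _ (h _ (proj2_sig x))).
by exists Z; split=> // y Zy; rewrite /= /fun_res_fun sZ.
Qed.

Lemma locally_constant_local (V : subopen U) (J : Type) (W : J -> subopen U)
    (c : forall j, W j `<=` V) : V `<=` \bigcup_j W j ->
  forall s : fun_sheaf V,
    (forall j, locally_constant (res _ (c j) s)) -> locally_constant s.
Proof.
move=> cov s sl [x Vx]; have [j _ Wx] := cov _ Vx.
have [Z [Zx sZ]] := sl j (exist _ x Wx).
exists (subopenI Z (W j)); split=> // -[y Vy] /= [Zy Wy].
rewrite (fun_sec_irr s Vy (c j y Wy)) (fun_sec_irr s Vx (c j x Wx)).
exact: sZ (exist _ y Wy) Zy.
Qed.

Definition constant_sheaf : sheaf R U :=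
  subsheaf (LocalCondition locally_constant_submodule locally_constant_res
    locally_constant_local).

End ConstantSheaf.

Section ZeroSheaf.
Context (R : realType) (T : topologicalType) (U : opens T) (F : sheaf R U).

Lemma zero_submodule (V : subopen U) : is_submodule [set s : F V | s = 0].
Proof.
by split=> // a x y; rewrite /= => -> ->; rewrite scaler0 addr0.
Qed.

Lemma zero_res (V W : subopen U) (h : W `<=` V) (s : F V) :
  s = 0 -> res _ h s = 0.
Proof. by move=> ->; rewrite linear0. Qed.

Lemma zero_local (V : subopen U) (J : Type) (W : J -> subopen U)
    (c : forall j, W j `<=` V) : V `<=` \bigcup_j W j ->
  forall s : F V, (forall j, res _ (c j) s = 0) -> s = 0.
Proof.
by move=> cov s s0; apply: (sheaf_sep cov (c := c)) => j; rewrite s0 linear0.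
Qed.

Definition zero_subsheaf : sheaf R U :=
  subsheaf (@LocalCondition _ _ _ F (fun V => [set s : F V | s = 0])
    zero_submodule zero_res zero_local).

Lemma zero_subsheaf_zero : is_zero_sheaf zero_subsheaf.
Proof. by move=> V s; apply: val_inj; exact: (submoduleP s). Qed.

End ZeroSheaf.

Section Complexes.
Context (R : realType) (T : topologicalType) (U : opens T).

Record complex := Complex {
  ob :> int -> sheaf R U;
  diff : forall i : int, hom (ob i) (ob (i + 1));
  diff_diff : forall (i : int) (V : subopen U) (s : ob i V),
    diff (i + 1) V (diff i V s) = 0;
  bounded_below : exists N : int, forall i : int, i < N -> is_zero_sheaf (ob i) }.

Implicit Types A B C : complex.

Record cmap A B := CMap {
  cmap_hom :> forall i : int, hom (A i) (B i);
  cmap_diff : forall (i : int) (V : subopen U) (s : A i V),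
    cmap_hom (i + 1) V (diff A i V s) = diff B i V (cmap_hom i V s) }.

Definition id_cmap A : cmap A A :=
  @CMap A A (fun i => id_hom (A i)) (fun i V s => erefl).

Lemma comp_cmap_diff A B C (g : cmap B C) (f : cmap A B) (i : int)
    (V : subopen U) (s : A i V) :
  comp_hom (g (i + 1)) (f (i + 1)) V (diff A i V s) =
  diff C i V (comp_hom (g i) (f i) V s).
Proof. by rewrite /= !cmap_diff. Qed.

Definition comp_cmap A B C (g : cmap B C) (f : cmap A B) : cmap A C :=
  CMap (comp_cmap_diff g f).

(* Every degree is of the form i + 1, so the condition below is the usual
   f - g = d h + h d in all degrees. *)
Definition homotopic A B (f g : cmap A B) : Prop :=
  exists h : forall i : int, hom (A (i + 1)) (B i),
    forall (i : int) (V : subopen U) (s : A (i + 1) V),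
      f (i + 1) V s - g (i + 1) V s =
      diff B i V (h i V s) + h (i + 1) V (diff A (i + 1) V s).

(* A cocycle of degree i + 1 defined near x. *)
Record cocycle A (i : int) (x : T) := Cocycle {
  cc_dom : subopen U;
  cc_mem : subopen_set cc_dom x;
  cc_sec : A (i + 1) cc_dom;
  cc_diff : diff A (i + 1) cc_dom cc_sec = 0 }.

(* Equality of classes in the stalk H^(i+1)(A)_x of the cohomology sheaf. *)
Definition cohomologous A (i : int) (x : T) (s t : cocycle A i x) : Prop :=
  exists (W : subopen U) (hs : W `<=` cc_dom s) (ht : W `<=` cc_dom t)
    (u : A i W), subopen_set W x /\
    res _ hs (cc_sec s) - res _ ht (cc_sec t) = diff A i W u.

Lemma cmap_cocycle_diff A B (f : cmap A B) (i : int) (x : T)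
    (s : cocycle A i x) :
  diff B (i + 1) (cc_dom s) (f (i + 1) (cc_dom s) (cc_sec s)) = 0.
Proof. by rewrite -cmap_diff cc_diff linear0. Qed.

Definition cmap_cocycle A B (f : cmap A B) (i : int) (x : T)
    (s : cocycle A i x) : cocycle B i x :=
  Cocycle (cc_mem s) (cmap_cocycle_diff f s).

(* f induces an isomorphism on every cohomology sheaf, i.e. a bijection on all
   stalks H^(i+1)(A)_x -> H^(i+1)(B)_x. *)
Definition quasi_iso A B (f : cmap A B) : Prop :=
  forall (i : int) (x : T), opens_set U x ->
    (forall s t : cocycle A i x,
       cohomologous (cmap_cocycle f s) (cmap_cocycle f t) -> cohomologous s t) /\
    (forall t : cocycle B i x,
       exists s : cocycle A i x, cohomologous (cmap_cocycle f s) t).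

(* The localization of the homotopy category K^+ at the quasi-isomorphisms:
   its morphisms are the formal composites of morphisms of complexes and of
   inverses of quasi-isomorphisms, modulo the congruence [dmor_eq]. *)
Inductive dmor : complex -> complex -> Type :=
| DMap A B : cmap A B -> dmor A B
| DInv A B (s : cmap A B) : quasi_iso s -> dmor B A
| DComp A B C : dmor B C -> dmor A B -> dmor A C.

Definition DId A : dmor A A := DMap (id_cmap A).

Inductive dmor_eq : forall A B, dmor A B -> dmor A B -> Prop :=
| dmor_refl A B (f : dmor A B) : dmor_eq f f
| dmor_sym A B (f g : dmor A B) : dmor_eq f g -> dmor_eq g f
| dmor_trans A B (f g h : dmor A B) :
    dmor_eq f g -> dmor_eq g h -> dmor_eq f h
| dmor_comp A B C (g g' : dmor B C) (f f' : dmor A B) :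
    dmor_eq g g' -> dmor_eq f f' -> dmor_eq (DComp g f) (DComp g' f')
| dmor_assoc A B C E (h : dmor C E) (g : dmor B C) (f : dmor A B) :
    dmor_eq (DComp h (DComp g f)) (DComp (DComp h g) f)
| dmor_idl A B (f : dmor A B) : dmor_eq (DComp (DId B) f) f
| dmor_idr A B (f : dmor A B) : dmor_eq (DComp f (DId A)) f
| dmor_map_comp A B C (g : cmap B C) (f : cmap A B) :
    dmor_eq (DMap (comp_cmap g f)) (DComp (DMap g) (DMap f))
| dmor_homotopic A B (f g : cmap A B) :
    homotopic f g -> dmor_eq (DMap f) (DMap g)
| dmor_invl A B (s : cmap A B) (qs : quasi_iso s) :
    dmor_eq (DComp (DInv qs) (DMap s)) (DId A)
| dmor_invr A B (s : cmap A B) (qs : quasi_iso s) :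
    dmor_eq (DComp (DMap s) (DInv qs)) (DId B).

Definition D_iso A B : Prop :=
  exists (f : dmor A B) (g : dmor B A),
    dmor_eq (DComp g f) (DId A) /\ dmor_eq (DComp f g) (DId B).

End Complexes.

Section ComplexOperations.
Context (R : realType) (T : topologicalType).

Section Restriction.
Context (U U' : opens T) (h : U `<=` U') (A : complex R U').

Lemma restrict_diff_diff (i : int) (V : subopen U)
    (s : restrict_sheaf h (A i) V) :
  restrict_hom h (diff A (i + 1)) V (restrict_hom h (diff A i) V s) = 0.
Proof. exact: diff_diff. Qed.

Lemma restrict_bounded : exists N : int, forall i : int, i < N ->
  is_zero_sheaf (restrict_sheaf h (A i)).
Proof.
have [N AN] := bounded_below A; exists N => i iN V s.
exact: (AN i iN (widen h V) s).
Qed.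

Definition restrict : complex R U :=
  Complex restrict_diff_diff restrict_bounded.

End Restriction.

Section Truncation.
Context (U : opens T) (j : int) (A : complex R U).

(* (tau_{<= j} A)^i is A^i for i < j, ker d^j for i = j and 0 for i > j. *)
Definition trunc_cond (i : int) (V : subopen U) : set (A i V) :=
  [set s | (i = j -> diff A i V s = 0) /\ (j < i -> s = 0)].

Lemma trunc_submodule i V : is_submodule (@trunc_cond i V).
Proof.
split; first by split=> _ //; rewrite linear0.
move=> a x y [xd x0] [yd y0]; split=> ij.
  by rewrite linearP xd // yd // scaler0 addr0.
by rewrite x0 // y0 // scaler0 addr0.
Qed.

Lemma trunc_res i (V W : subopen U) (k : W `<=` V) (s : A i V) :
  trunc_cond s -> trunc_cond (res _ k s).
Proof.
move=> [sd s0]; split=> ij; first by rewrite hom_nat sd // linear0.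
by rewrite s0 // linear0.
Qed.

Lemma trunc_local i (V : subopen U) (J : Type) (W : J -> subopen U)
    (c : forall l, W l `<=` V) : V `<=` \bigcup_l W l ->
  forall s : A i V, (forall l, trunc_cond (res _ (c l) s)) -> trunc_cond s.
Proof.
move=> cov s sl; split=> ij; apply: (sheaf_sep cov (c := c)) => l.
  by rewrite linear0 -hom_nat (sl l).1.
by rewrite linear0 (sl l).2.
Qed.

Definition trunc_ob (i : int) : sheaf R U :=
  subsheaf (LocalCondition (@trunc_submodule i) (@trunc_res i) (@trunc_local i)).

Lemma trunc_diff_cond i (V : subopen U) (s : A i V) :
  trunc_cond s -> trunc_cond (diff A i V s).
Proof.
move=> [sd s0]; split=> ij; first exact: diff_diff.
have [/sd //|ij'] := eqVneq i j.
by rewrite s0 ?linear0 // lt_neqAle eq_sym ij' -ltzD1.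
Qed.

Definition trunc_diff (i : int) : hom (trunc_ob i) (trunc_ob (i + 1)) :=
  subhom (P := LocalCondition (@trunc_submodule i) (@trunc_res i) (@trunc_local i))
    (Q := LocalCondition (@trunc_submodule (i + 1)) (@trunc_res (i + 1))
      (@trunc_local (i + 1))) (f := diff A i) (@trunc_diff_cond i).

Lemma trunc_diff_diff (i : int) (V : subopen U) (s : trunc_ob i V) :
  trunc_diff (i + 1) V (trunc_diff i V s) = 0.
Proof. by apply: val_inj; exact: diff_diff. Qed.

Lemma trunc_bounded : exists N : int, forall i : int, i < N ->
  is_zero_sheaf (trunc_ob i).
Proof.
have [N AN] := bounded_below A; exists N => i iN V s.
by apply: val_inj; exact: (AN i iN V).
Qed.

Definition trunc : complex R U := Complex trunc_diff_diff trunc_bounded.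

End Truncation.

Section DirectImage.
Context (U U' : opens T).

Section Push.
Context (A : complex R U).

Lemma push_diff_diff (i : int) (V : subopen U') (s : push_sheaf U' (A i) V) :
  push_hom U' (diff A (i + 1)) V (push_hom U' (diff A i) V s) = 0.
Proof. exact: diff_diff. Qed.

Lemma push_bounded : exists N : int, forall i : int, i < N ->
  is_zero_sheaf (push_sheaf U' (A i)).
Proof.
have [N AN] := bounded_below A; exists N => i iN V s.
exact: (AN i iN (trace U V) s).
Qed.

Definition push : complex R U' := Complex push_diff_diff push_bounded.

End Push.

Definition injective_resolution (A I : complex R U) : Prop :=
  (exists r : cmap A I, quasi_iso r) /\ forall i : int, injective_sheaf (I i).

(* A chosen injective resolution.  Sheaves of vector spaces have enough
   injectives, so every bounded below complex has one and the default value A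
   is never used. *)
Definition resolve (A : complex R U) : complex R U :=
  if pselect (exists I, injective_resolution A I) is left e
  then projT1 (cid e) else A.

Definition Rpush (i : U `<=` U') (A : complex R U) : complex R U' :=
  push (resolve A).

End DirectImage.

Section ConstantComplex.
Context (U : opens T).

Definition constant_ob (i : int) : sheaf R U :=
  if i == 0 then constant_sheaf R U else zero_subsheaf (constant_sheaf R U).

Lemma constant_diff_diff (i : int) (V : subopen U) (s : constant_ob i V) :
  zero_hom (constant_ob (i + 1)) (constant_ob (i + 1 + 1)) V
    (zero_hom (constant_ob i) (constant_ob (i + 1)) V s) = 0.
Proof. by []. Qed.

Lemma constant_bounded : exists N : int, forall i : int, i < N ->
  is_zero_sheaf (constant_ob i).
Proof.
exists 0 => i i0; rewrite /constant_ob lt_eqF //; exact: zero_subsheaf_zero.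
Qed.

Definition constant_complex : complex R U :=
  @Complex R T U constant_ob (fun i => zero_hom _ _) constant_diff_diff
    constant_bounded.

End ConstantComplex.

End ComplexOperations.

(* PL spaces are modelled by polyhedra: subsets of a space R^I, with the
   product topology, that are near each of their points a finite union of
   convex hulls of finite sets.  The realization |K| of a simplicial complex is
   one if and only if K is locally finite, and the product topology of |K| is
   then the usual one; every compact PL space embeds in some R^m. *)

Section PL.
Context (R : realType).

Definition nbhs_in (I : Type) (P : set (I -> R)) (x : I -> R)
    (N : set (I -> R)) : Prop :=
  N `<=` P /\ within P (nbhs (x : {ptws I -> R})) N.

Definition is_weight (p : nat) (w : 'I_p -> R) : Prop :=
  (forall j, 0 <= w j) /\ \sum_j w j = 1.

Definition hull (I : Type) (p : nat) (v : 'I_p -> I -> R) : set (I -> R) :=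
  [set x | exists2 w, is_weight w & x = \sum_j w j *: v j].

Definition affine_on_hull (I J : Type) (p : nat) (v : 'I_p -> I -> R)
    (f : (I -> R) -> (J -> R)) : Prop :=
  forall w, is_weight w -> f (\sum_j w j *: v j) = \sum_j w j *: f (v j).

(* The hulls may be given with repeated points, so that a common number p of
   points is no restriction. *)
Definition PL_map (I J : Type) (P : set (I -> R)) (f : (I -> R) -> (J -> R)) :
    Prop :=
  forall x, P x -> exists (q p : nat) (v : 'I_q -> 'I_p -> I -> R),
    nbhs_in P x (\bigcup_i hull (v i)) /\ forall i, affine_on_hull (v i) f.

Definition polyhedron (I : Type) (P : set (I -> R)) : Prop :=
  forall x, P x -> exists (q p : nat) (v : 'I_q -> 'I_p -> I -> R),
    nbhs_in P x (\bigcup_i hull (v i)).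

Definition PL_homeo (I J : Type) (P : set (I -> R)) (Q : set (J -> R))
    (f : (I -> R) -> (J -> R)) : Prop :=
  exists g : (J -> R) -> (I -> R),
    [/\ forall x, P x -> Q (f x) /\ g (f x) = x,
        forall y, Q y -> P (g y) /\ f (g y) = y,
        PL_map P f & PL_map Q g].

Definition PL_space (I : Type) (P : set (I -> R)) : Prop :=
  polyhedron P /\ @second_countable (set_type (P : set {ptws I -> R})).

Definition closed_in (I : Type) (P Q : set (I -> R)) : Prop :=
  closure (Q : set {ptws I -> R}) `&` P `<=` Q.

Definition PL_manifold (k : nat) (I : Type) (P : set (I -> R)) : Prop :=
  PL_space P /\
  forall x, P x -> exists (N : set (I -> R)) f,
    nbhs_in P x N /\ PL_homeo (setT : set ('I_k -> R)) N f.

(* The open cone on L, as the points (t z, t) of R^J x R with z in L and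
   0 < t < 1, together with the cone point 0 (so the cone on the empty set is
   a point). *)
Definition open_cone (J : Type) (L : set (J -> R)) : set (option J -> R) :=
  [set y | y = 0 \/ exists (t : R) (z : J -> R),
    [/\ 0 < t < 1, L z, y None = t & forall j, y (Some j) = t * z j]].

(* The j-th stage of R^k x cL, which is R^k x c(L_(j-k-1)) for j >= k and
   empty for j < k. *)
Definition cone_stage (k : nat) (J : Type) (L : int -> set (J -> R)) (j : int) :
    set (('I_k + option J)%type -> R) :=
  [set w : ('I_k + option J)%type -> R | k%:Z <= j /\ open_cone (L (j - k%:Z - 1)) (w \o inr)].

(* Dimensions and filtration indices are integers, with P_j empty for j < 0:
   the link of a point of P_n - P_(n-1) is the empty space, of dimension -1.
   The stages P_j with j > n play no role. *)
Inductive PL_pseudomanifold (n : int) (I : Type) (P : int -> set (I -> R)) :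
    Prop :=
  PLPseudomanifold of
    (forall j, j < 0 -> P j = set0) &
    (forall j, j < n -> P j `<=` P (j + 1)) &
    P (n - 2) = P (n - 1) &
    (forall j, j <= n -> PL_space (P j) /\ closed_in (P n) (P j)) &
    P n `<=` closure (P n `\` P (n - 2) : set {ptws I -> R}) &
    (forall k : nat, k%:Z <= n -> PL_manifold k (P k%:Z `\` P (k%:Z - 1))) &
    (forall (k : nat) x, k%:Z <= n -> (P k%:Z `\` P (k%:Z - 1)) x ->
      exists (m : nat) (L : int -> set ('I_m -> R)) (N : set (I -> R)) f,
        [/\ PL_pseudomanifold (n - k%:Z - 1) L,
            compact (L (n - k%:Z - 1) : set {ptws 'I_m -> R}),
            nbhs_in (P n) x N,
            PL_homeo (cone_stage (k := k) L n) N f &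
            forall j, j <= n -> f @` cone_stage L j = N `&` P j]).

(* |K|, in barycentric coordinates indexed by the vertices. *)
Definition realization (T : choiceType) (K : scomplex T) : set (T -> R) :=
  [set x | exists s, [/\ simplices K s, forall v, 0 <= x v,
    forall v, v \notin s -> x v = 0 & \sum_(v <- s) x v = 1]].

End PL.

Arguments realization R {T} K _.

(* Only the values on k >= 2 play a role. *)
Definition GM_perversity (p : nat -> int) : Prop :=
  p 2 = 0 /\ forall k, (2 <= k)%N -> p k <= p k.+1 <= p k + 1.

Section Deligne.
Context (R : realType) (T : choiceType) (K : scomplex T) (n : nat).
Context (X : filtration K n) (p : nat -> int).

Definition restrictU (k : nat) (F : complex R (full_opens (fst_space K))) :
    complex R (Udelta X k) :=
  restrict (@subsetT _ (Udelta X k) : Udelta X k `<=` full_opens _) F.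

Definition deligne_axioms (F : complex R (full_opens (fst_space K))) : Prop :=
  D_iso (restrictU 2 F) (constant_complex R (Udelta X 2)) /\
  forall k, (2 <= k <= n)%N ->
    D_iso (restrictU k.+1 F)
      (trunc (p k) (Rpush (@Udelta_le _ _ _ X k) (restrictU k F))).

(* The m-fold composite, on U_(m+2). *)
Fixpoint deligne_rec (m : nat) : complex R (Udelta X m.+2) :=
  if m is l.+1 then
    trunc (p l.+2) (Rpush (@Udelta_le _ _ _ X l.+2) (deligne_rec l))
  else constant_complex R (Udelta X 2).

Lemma deligne_top : full_opens (fst_space K) `<=` Udelta X n.-1.+2.
Proof. by apply: Udelta_top; case: n. Qed.

(* The composite of the n - 1 steps k = 2, ..., n is a complex on U_(n+1), and
   U_(n+1) = X; it is transported along this equality. *)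
Definition deligne_complex : complex R (full_opens (fst_space K)) :=
  restrict deligne_top (deligne_rec n.-1).

End Deligne.

(* Main.v *)
(* Both directions rest on the invariance of the two operations of (AX 2)
   under isomorphism in the derived category and on the equivalence
     (tau_{<= p(k)} R(i_k)_* A)|U_k = tau_{<= p(k)} A = A
   for A with no cohomology above degree p(k).  Truncation preserves
   quasi-isomorphisms; for R(i_k)_*, a derived isomorphism between bounded below
   complexes of injectives is a homotopy equivalence, because [-, I] inverts
   quasi-isomorphisms when I is such a complex, and direct images preserve
   homotopy equivalences.
   Injective resolutions exist because every point c of (X, T) has a smallest
   neighbourhood N_c, namely fst(s) with s the largest simplex in the smallest
   element of the chain c.  Stalks are then sections over N_c, a product of
   skyscrapers is injective by linear algebra, and A embeds in the total complex
   of its bar construction: cochains on sequences x0, x1, ..., xp with x_(k+1)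
   in N_(x_k) and values in A(N_(xp)). *)

From HB Require Import structures.
From mathcomp Require Import all_boot all_order all_algebra finmap.
From mathcomp Require Import all_classical reals topology normedtype.
From mathcomp Require Import zify.
(* Last, because MathComp's vector library also defines [hom]. *)
Require Import Defs.

Set Implicit Arguments.
Unset Strict Implicit.
Unset Printing Implicit Defensive.

Import Order.TTheory GRing.Theory Num.Theory.
Import numFieldNormedType.Exports.

Local Open Scope classical_set_scope.
Local Open Scope ring_scope.

(** * Linear algebra *)

(** A derived isomorphism is given by words of arbitrary length in maps and formal inverses of
    quasi-isomorphisms, not by single roofs. Words are therefore studied through their action on
    homotopy classes of maps into a complex of injectives, where pullback along a quasi-isomorphism
    is bijective; both halves of this bijectivity come from a null homotopy on the mapping cone.
    Restriction and truncation act on words letter by letter. Direct image does not preserve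
    quasi-isomorphisms, and its derived version is given on objects only, through a chosen
    resolution; hence an isomorphism must first be carried over to the resolutions. Since that
    choice falls back on the complex itself when there is no resolution, enough injectives have to
    be constructed on the space. The perversity enters through p(2) = 0 and monotonicity: they make
    the iterated complex on U_k vanish above p(k), so that the next truncation keeps it and an
    isomorphism over X restricts to one over every U_k. *)

Definition lin_of (R : pzRingType) (V W : lmodType R) (f : V -> W)
    (lin : linear f) : {linear V -> W} :=
  HB.pack f (GRing.isLinear.Build R V W *:%R f lin).

Section LinearExtension.
Context (K : fieldType) (F G M : lmodType K).
Context (i : {linear F -> G}) (f : {linear F -> M}).

Definition linear_graph (A : set (G * M)) : Prop :=
  (forall a x y, A x -> A y -> A (a *: x + y)) /\ (forall u, A (0, u) -> u = 0).

Let base : set (G * M) := [set (i s, f s) | s in setT].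

(** A maximal linear graph containing that of [f] on the image of [i] is total, since a point
    outside its domain could be adjoined with value 0. Zorn's lemma is applied to the sets [A] whose
    union with [base] is a linear graph, which covers the empty chain too. *)
Lemma linear_extension :
  injective i -> exists g : {linear G -> M}, forall s, g (i s) = f s.
Proof.
move=> inj_i.
have base_graph : linear_graph base.
  split=> [a _ _ [s _ <-] [t _ <-]|u [s _ [s0 <-]]].
    by exists (a *: s + t) => //; rewrite !linearP.
  by rewrite (_ : s = 0) ?linear0 //; apply: inj_i; rewrite linear0.
have [F0 chainF|A [graphB maxA]] := @Zorn_bigcup _ (fun A => linear_graph (A `|` base)).
  move=> tot; split=> [a x y|u].
  - move=> Ax Ay; suff [X [FX Xx Xy]] : exists X, [/\ F0 X \/ X = set0,
        (X `|` base) x & (X `|` base) y].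
      have : (X `|` base) (a *: x + y).
        case: FX Xx Xy => [FX Xx Xy|->]; first exact: (chainF _ FX).1.
        by rewrite set0U; exact: base_graph.1.
      by case=> [Xz|bz]; [left; case: FX Xz => [FX Xz|-> []]; exists X|right].
    case: Ax Ay => [[X FX Xx]|bx] [[Y FY Yy]|by_].
    + have [XY|YX] := tot _ _ FX FY.
        by exists Y; split; [left|left; exact: XY|left].
      by exists X; split; [left|left|left; exact: YX].
    + by exists X; split; [left|left|right].
    + by exists Y; split; [left|right|left].
    + by exists set0; split; [right|right|right].
  - move=> [[X FX Xu]|bu]; last exact: base_graph.2.
    by apply: (chainF _ FX).2; left.
set B := A `|` base in graphB.
have [linB funB] := graphB.
have B0 : B (0, 0) by right; exists 0 => //; rewrite !linear0.
have BZ a x u : B (x, u) -> B (a *: x, a *: u).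
  by move=> Bx; have := linB a _ _ Bx B0; rewrite addr0.
have BD x y u v : B (x, u) -> B (y, v) -> B (x + y, u + v).
  by move=> Bx By; have := linB 1 _ _ Bx By; rewrite scale1r.
have Bfun x u v : B (x, u) -> B (x, v) -> u = v.
  move=> Bu Bv; apply/subr0_eq/funB.
  by have := linB (-1) _ _ Bv Bu; rewrite scaleN1r addrC -[_ + _]/(x - x, u - v) subrr.
have total x : exists u, B (x, u).
  apply: contrapT => ndom.
  pose C : set (G * M) := [set (y.1 + a *: x, y.2) | y in B & a in setT].
  have Cx : C (x, 0) by exists (0, 0) => //; exists 1 => //=; rewrite scale1r add0r.
  have AC : A `<=` C.
    by move=> [y u] Ay; exists (y, u); [left|exists 0 => //=; rewrite scale0r addr0].
  have bC : base `<=` C.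
    by move=> [y u] by_; exists (y, u); [right|exists 0 => //=; rewrite scale0r addr0].
  apply: (maxA C).
    by split=> // CA; apply: ndom; exists 0; left; exact: CA.
  rewrite (_ : C `|` base = C); last by apply/setUidPl.
  split=> [a _ _ [[y u] By [b _ <-]] [[z v] Bz [c _ <-]]|u [[y v] By [a _ /= [yx <-]]]].
    exists (a *: y + z, a *: u + v); first exact: (linB a (y, u) (z, v)).
    exists (a * b + c) => //=.
    rewrite -[RHS]/(a *: (y + b *: x) + (z + c *: x), a *: u + v).
    by rewrite scalerDl scalerDr -scalerA addrACA.
  have a0 : a = 0.
    apply/eqP; apply: contrapT => /negP a0; apply: ndom; exists (- a^-1 *: v).
    rewrite (_ : x = - a^-1 *: y); first exact: BZ.
    apply: (scalerI a0); rewrite scaleNr scalerN scalerA divff // scale1r.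
    by apply/eqP; rewrite -addr_eq0 addrC yx.
  by apply: funB; move: yx By; rewrite a0 scale0r addr0 => ->.
pose g x := xget 0 [set u | B (x, u)].
have gP x : B (x, g x).
  by have [u Bu] := total x; exact: (xgetPex 0 (P := [set u | B (x, u)])) (total x).
have lin_g : linear g.
  by move=> a x y; apply: (Bfun (a *: x + y)) => //; apply: BD => //; exact: BZ.
exists (lin_of lin_g) => s.
by apply: (Bfun (i s)); [exact: gP|right; exists s].
Qed.
End LinearExtension.

Section DependentProduct.
Context (R : pzRingType) (I : Type) (M : I -> lmodType R).

Definition dprod : Type := forall i, M i.

HB.instance Definition _ := gen_eqMixin dprod.
HB.instance Definition _ := gen_choiceMixin dprod.

Let add (f g : dprod) : dprod := fun i => f i + g i.
Let opp (f : dprod) : dprod := fun i => - f i.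
Let scale (a : R) (f : dprod) : dprod := fun i => a *: f i.

Lemma dprod_addA : associative add.
Proof. by move=> f g h; apply: functional_extensionality_dep => i; exact: addrA. Qed.

Lemma dprod_addC : commutative add.
Proof. by move=> f g; apply: functional_extensionality_dep => i; exact: addrC. Qed.

Lemma dprod_add0 : left_id (fun i => 0) add.
Proof. by move=> f; apply: functional_extensionality_dep => i; exact: add0r. Qed.

Lemma dprod_addN : left_inverse (fun i => 0) opp add.
Proof. by move=> f; apply: functional_extensionality_dep => i; exact: addNr. Qed.

HB.instance Definition _ :=
  GRing.isZmodule.Build dprod dprod_addA dprod_addC dprod_add0 dprod_addN.

Lemma dprod_scaleA a b f : scale a (scale b f) = scale (a * b) f.
Proof. by apply: functional_extensionality_dep => i; exact: scalerA. Qed.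

Lemma dprod_scale1 : left_id 1 scale.
Proof. by move=> f; apply: functional_extensionality_dep => i; exact: scale1r. Qed.

Lemma dprod_scaleDr : right_distributive scale +%R.
Proof. by move=> a f g; apply: functional_extensionality_dep => i; exact: scalerDr. Qed.

Lemma dprod_scaleDl f : {morph scale^~ f : a b / a + b}.
Proof. by move=> a b; apply: functional_extensionality_dep => i; exact: scalerDl. Qed.

HB.instance Definition _ := GRing.Zmodule_isLmodule.Build R dprod
  dprod_scaleA dprod_scale1 dprod_scaleDr dprod_scaleDl.

End DependentProduct.

Section HomOf.
Context (R : realType) (T : topologicalType) (U : opens T).
Context (F G : sheaf R U) (f : forall V : subopen U, F V -> G V).
Hypothesis lin_f : forall V, linear (@f V).
Hypothesis nat_f : forall (V W : subopen U) (h : W `<=` V) (s : F V),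
  f (res F h s) = res G h (f s).

Definition hom_of : hom F G := @Hom _ _ _ F G (fun V => lin_of (@lin_f V)) nat_f.

End HomOf.

(** * Products of skyscraper sheaves *)

Section ProductSheaf.
Context (R : realType) (T : topologicalType) (U : opens T) (M : T -> lmodType R).

Definition prod_sec (V : subopen U) : lmodType R :=
  dprod (fun x : {x : T | subopen_set V x} => M (sval x)).

Lemma prod_sec_irr (V : subopen U) (s : prod_sec V) x p q :
  s (exist _ x p) = s (exist _ x q).
Proof. by rewrite (Prop_irrelevance p q). Qed.

Definition prod_res_fun (V W : subopen U) (h : W `<=` V) (s : prod_sec V) :
  prod_sec W := fun x => s (exist _ (sval x) (h _ (proj2_sig x))).

Lemma prod_res_linear (V W : subopen U) (h : W `<=` V) : linear (prod_res_fun h).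
Proof. by []. Qed.

Definition prod_res (V W : subopen U) (h : W `<=` V) : {linear prod_sec V -> prod_sec W} :=
  lin_of (prod_res_linear h).

Lemma prod_res_id (V : subopen U) (k : V `<=` V) (s : prod_sec V) :
  prod_res k s = s.
Proof.
apply: functional_extensionality_dep => -[x Vx]; exact: (@prod_sec_irr V s x (k x Vx)).
Qed.

Lemma prod_res_comp (V W Z : subopen U) (k : W `<=` V) (k' : Z `<=` W)
    (k'' : Z `<=` V) (s : prod_sec V) :
  prod_res k' (prod_res k s) = prod_res k'' s.
Proof.
apply: functional_extensionality_dep => -[x Vx]; exact: (@prod_sec_irr V s x (k x (k' x Vx))).
Qed.

Lemma prod_sep (V : subopen U) (J : Type) (W : J -> subopen U)
    (c : forall j, W j `<=` V) : V `<=` \bigcup_j W j ->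
  forall s t : prod_sec V,
    (forall j, prod_res (c j) s = prod_res (c j) t) -> s = t.
Proof.
move=> cov s t st; apply: functional_extensionality_dep => -[x Vx].
have [j _ Wx] := cov _ Vx.
rewrite (prod_sec_irr s Vx (c j x Wx)) (prod_sec_irr t Vx (c j x Wx)).
exact: (congr1 (fun g : prod_sec (W j) => g (exist _ x Wx)) (st j)).
Qed.

Lemma prod_glue (V : subopen U) (J : Type) (W : J -> subopen U)
    (c : forall j, W j `<=` V) : V `<=` \bigcup_j W j ->
  forall s : forall j, prod_sec (W j),
  (forall i j,
    prod_res (@subIsetl _ (W i) (W j) : subopenI (W i) (W j) `<=` W i) (s i) =
    prod_res (@subIsetr _ (W i) (W j) : subopenI (W i) (W j) `<=` W j) (s j)) ->
  exists t : prod_sec V, forall j, prod_res (c j) t = s j.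
Proof.
move=> cov s comp.
have pick (x : {x : T | subopen_set V x}) : {j | subopen_set (W j) (sval x)}.
  by apply: cid; have [j _ Wx] := cov _ (svalP x); exists j.
exists (fun x => s (sval (pick x)) (exist _ (sval x) (svalP (pick x)))) => j.
apply: functional_extensionality_dep => -[x Wx]; rewrite /= /prod_res_fun /=.
case: (pick _) => i /= Wix.
have e := congr1 (fun g : prod_sec (subopenI (W i) (W j)) =>
  g (exist _ x (conj Wix Wx))) (comp i j).
rewrite [LHS](@prod_sec_irr _ (s i) x _ (subIsetl (conj Wix Wx))).
exact: etrans e (@prod_sec_irr _ (s j) x (subIsetr (conj Wix Wx)) Wx).
Qed.

Definition prod_sheaf : sheaf R U :=
  Sheaf prod_res_id prod_res_comp prod_sep prod_glue.

Context (N : T -> subopen U).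
Hypothesis N_mem : forall x : T, opens_set U x -> subopen_set (N x) x.
Hypothesis N_min : forall (V : subopen U) (x : T), subopen_set V x -> N x `<=` V.

(* The stalk at x is the space of sections over the smallest neighbourhood
   of x, so that Hom(G, prod_sheaf) is the product of the Hom(G_x, M x). *)
Lemma prod_sheaf_injective : injective_sheaf prod_sheaf.
Proof.
move=> F G m f inj_m.
have Ux (V : subopen U) (x : {x | subopen_set V x}) : subopen_set (N (sval x)) (sval x).
  by apply: N_mem; apply: subopen_sub (svalP x).
have ext (x : T) : {g : G (N x) -> M x | linear g /\ forall (s : F (N x)) p,
    g (m _ s) = f (N x) s (exist _ x p)}.
  (* A point outside [U] is not in [N x]; the zero map then meets the condition vacuously. *)
  apply: cid; have [p|np] := pselect (subopen_set (N x) x); last first.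
    by exists (fun=> 0); split=> [a u v|s p //]; rewrite scaler0 addr0.
  have lin_fx : linear (fun s : F (N x) => f (N x) s (exist _ x p) : M x).
    by move=> a u v; rewrite linearP.
  have [g gP] := linear_extension (lin_of lin_fx) (inj_m (N x)).
  exists g; split=> [|s q]; first exact: linearP.
  by rewrite gP /=; exact: prod_sec_irr.
pose g (V : subopen U) (s : G V) : prod_sheaf V :=
  fun x => sval (ext (sval x)) (res G (N_min (svalP x)) s).
have lin_g V : linear (@g V).
  move=> a u v; apply: functional_extensionality_dep => x; rewrite /g linearP.
  by have [->] := svalP (ext (sval x)).
have nat_g (V W : subopen U) (h : W `<=` V) (s : G V) :
    g W (res G h s) = res prod_sheaf h (g V s).
  apply: functional_extensionality_dep => x; rewrite /g /= /prod_res_fun /=.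
  by congr (sval _ _); exact: res_comp.
exists (hom_of lin_g nat_g) => V s; apply: functional_extensionality_dep => x /=.
rewrite /g -hom_nat; have [_ gm] := svalP (ext (sval x)).
case: x gm => x Vx /= gm; rewrite (gm _ (Ux V (exist _ x Vx))) hom_nat /=.
by rewrite /prod_res_fun [LHS](@prod_sec_irr V (f V s) x _ Vx).
Qed.

End ProductSheaf.

(* A cochain g is a function of chains y :: c with values in E (last y c), and
   [face_diff le r (fun=> 0) g] is the alternating sum of its values on the faces of a
   chain, cut off to 0 on sequences that are not chains.  The argument a is the
   value of g at the empty chain; it makes the recursion on the chain uniform. *)
Section ChainDifferential.
Context (R : pzRingType) (T : Type) (le : rel T).

Fixpoint face_diff (E : T -> lmodType R) (r : forall y z, {linear E y -> E z})
    (a : forall y, E y) (g : forall y c, E (last y c)) (y : T) (c : seq T) :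
    E (last y c) :=
  if c is z :: d then
    if le y z then
      g z d - face_diff r (fun w => r y w (g y [::])) (fun w b => g y (w :: b)) z d
    else 0
  else a y.

Context (E : T -> lmodType R) (r : forall y z, {linear E y -> E z}).
Implicit Types (a b : forall y, E y) (g h : forall y c, E (last y c)).

Lemma face_diffP k a b g h y c :
  face_diff r (fun w => k *: a w + b w) (fun w d => k *: g w d + h w d) y c =
  k *: face_diff r a g y c + face_diff r b h y c.
Proof.
elim: c y a b g h => [//|z c IH] y a b g h /=; case: ifP => _; last first.
  by rewrite scaler0 addr0.
rewrite scalerBr addrACA -opprD -IH; congr (_ - face_diff _ _ _ _ _).
by apply: functional_extensionality_dep => w; rewrite linearP.
Qed.

Lemma face_diff_morph (E' : T -> lmodType R) (r' : forall y z, {linear E' y -> E' z})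
    (f : forall y, {linear E y -> E' y}) a g y c :
  (forall y z e, f z (r y z e) = r' y z (f y e)) ->
  f (last y c) (face_diff r a g y c) =
  face_diff r' (fun w => f w (a w)) (fun w d => f (last w d) (g w d)) y c.
Proof.
move=> fr; elim: c y a g => [//|z c IH] y a g /=; case: ifP => _; last first.
  by rewrite linear0.
rewrite linearB IH; congr (_ - face_diff _ _ _ _ _).
by apply: functional_extensionality_dep => w; rewrite fr.
Qed.

Lemma face_diff_eq0 a g y c : (forall w, c = [::] -> a w = 0) ->
  (forall w d, (size d).+1 = size c -> g w d = 0) -> face_diff r a g y c = 0.
Proof.
elim: c y a g => [|z c IH] y a g a0 g0 /=; first exact: a0.
case: ifP => // _; rewrite g0 // IH ?subr0 // => [w c0|w d dc].
  by rewrite g0 ?linear0 // c0.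
by rewrite g0 //= dc.
Qed.

Lemma face_diff_support a g y c : (forall w d, ~~ path le w d -> g w d = 0) ->
  ~~ path le y c -> face_diff r a g y c = 0.
Proof.
elim: c y a g => [//|z c IH] y a g g0 /=; case: ifP => //= yz nzc.
rewrite g0 // IH ?subr0 // => w d nwd.
by rewrite g0 //= (negbTE nwd) andbF.
Qed.

(** A chain that starts in an upward closed set stays in it, and so do its faces. This makes the
    face differential local, hence compatible with restriction. *)
Lemma face_diff_ext (S : set T) a b g h y c :
  (forall w z, S w -> le w z -> S z) -> S y ->
  (forall w, S w -> a w = b w) -> (forall w d, S w -> g w d = h w d) ->
  face_diff r a g y c = face_diff r b h y c.
Proof.
move=> Sle; elim: c y a b g h => [|z c IH] y a b g h Sy ab gh /=; first exact: ab.
case: ifP => // yz; have Sz := Sle _ _ Sy yz.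
by rewrite gh // (IH z _ (fun w => r y w (h y [::])) _ (fun w d => h y (w :: d)))
  // => w *; rewrite gh.
Qed.

Hypothesis le_tr : forall x y z, le x y -> le y z -> le x z.
Hypothesis r_comp : forall x y z e, le x y -> le y z -> r y z (r x y e) = r x z e.

(** Induction on the chain. With the first point [y] fixed, the inner differential is [g - g'],
    where [g'] is itself a differential, on chains with [y] removed, so that the induction
    hypothesis applies to it. The condition on [a] says that the values at the empty chain are
    compatible with [r]; for [g'] this is [r_comp]. *)
Lemma face_diff_face_diff a g y c : (forall w, le y w -> a w = r y w (a y)) ->
  face_diff r (fun=> 0) (face_diff r a g) y c = 0.
Proof.
elim: c y a g => [//|z c IH] y a g ay /=; case: ifP => // yz.
pose g' := face_diff r (fun w => r y w (g y [::])) (fun w d => g y (w :: d)).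
rewrite [X in _ - X](@face_diff_ext (le y) _ (fun w => -1 *: 0 + r y w (a y)) _
  (fun w d => -1 *: g' w d + g w d)) //; first last.
- by move=> w d /= ->; rewrite scaleN1r addrC.
- by move=> w _; rewrite scaler0 add0r.
- by move=> w v; exact: le_tr.
rewrite face_diffP IH; last by move=> w zw; rewrite r_comp.
rewrite scaler0 add0r; apply/eqP; rewrite subr_eq0; apply/eqP.
by case: c {IH} => [|v c] //=; rewrite ay.
Qed.

End ChainDifferential.

(** * The bar resolution *)

(** Differentials land in degrees of the form i + 1; this brings an arbitrary degree to that
    form. *)
Lemma int_succ (P : int -> Prop) : (forall i, P (i + 1)) -> forall j, P j.
Proof. by move=> PS j; rewrite -(subrK 1 j). Qed.

Section Graded.
Context (R : realType) (T : topologicalType) (U : opens T) (A : complex R U).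
Implicit Types V W : subopen U.

Definition degree_cast W i j (e : i = j) (s : A i W) : A j W :=
  eq_rect i (fun k => A k W) s j e.

Definition graded W : lmodType R := dprod (fun i : int => A i W).

(** The degree j - 1 + 1 equals j only propositionally, hence the cast; [graded_diffE] removes it in
    degrees i + 1. *)
Definition graded_diff W (e : graded W) : graded W :=
  fun j => degree_cast (subrK 1 j) (diff A (j - 1) W (e (j - 1))).

Lemma graded_diffE W (e : graded W) i : graded_diff e (i + 1) = diff A i W (e i).
Proof.
rewrite /graded_diff; move: (subrK 1 (i + 1)); move: (i + 1 - 1) (addrK 1 i) => k ->.
by move=> e1; rewrite (eq_irrelevance e1 erefl).
Qed.

Lemma graded_diff_linear W : linear (@graded_diff W).
Proof.
move=> a s t; apply: functional_extensionality_dep; apply: int_succ => i.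
by rewrite graded_diffE linearP -!graded_diffE.
Qed.

Definition single W m (s : A m W) : graded W :=
  fun i => if pselect (m = i) is left e then degree_cast e s else 0.

Lemma single_id W m (s : A m W) : single s m = s.
Proof.
by rewrite /single; case: pselect => // e; rewrite (eq_irrelevance e erefl).
Qed.

Lemma single_neq W m (s : A m W) i : m != i -> single s i = 0.
Proof. by move=> /eqP ne; rewrite /single; case: pselect => // e; case: (ne e). Qed.

Lemma graded_diff_single W m (s : A m W) : graded_diff (single s) = single (diff A m W s).
Proof.
apply: functional_extensionality_dep; apply: int_succ => i; rewrite graded_diffE.
have [<-|ne] := eqVneq m i; first by rewrite !single_id.
by rewrite !single_neq ?linear0 //; apply: contra ne => /eqP/addIr ->.
Qed.

Lemma single_linear W m : linear (@single W m).
Proof.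
move=> a s t; apply: functional_extensionality_dep => i; rewrite /single.
have [<-|ne] := eqVneq m i.
  by rewrite -[LHS]/(single _ _) -[RHS]/(a *: single s m + single t m) !single_id.
rewrite -[LHS]/(single _ _) -[RHS]/(a *: single s i + single t i).
by rewrite !single_neq // scaler0 addr0.
Qed.

End Graded.

Section BarResolution.
Context (R : realType) (T : topologicalType) (U : opens T) (A : complex R U).
Context (N : T -> subopen U).
Hypothesis N_mem : forall x : T, opens_set U x -> subopen_set (N x) x.
Hypothesis N_min : forall (V : subopen U) (x : T), subopen_set V x -> N x `<=` V.
Implicit Types V W : subopen U.

Let le : rel T := fun y z => `[< subopen_set (N y) z >].

Lemma le_sub y z : le y z -> N z `<=` N y.
Proof. by move=> /asboolP; exact: N_min. Qed.

Lemma bar_le_trans x y z : le x y -> le y z -> le x z.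
Proof. by move=> /le_sub xy /asboolP /xy yz; apply/asboolP. Qed.

Lemma le_upclosed V w z : subopen_set V w -> le w z -> subopen_set V z.
Proof. by move=> /N_min sub /asboolP /sub. Qed.

(** Defined for all pairs, with value 0 where there is no inclusion, because [face_diff] takes a
    family of maps indexed by all pairs of points. *)
Definition stalk_res i y z : {linear A i (N y) -> A i (N z)} :=
  if pselect (N z `<=` N y) is left h then res (A i) h else
  [the {linear A i (N y) -> A i (N z)} of \0].

Lemma stalk_resE i y z (h : N z `<=` N y) e : stalk_res i y z e = res (A i) h e.
Proof. by rewrite /stalk_res; case: pselect => // k; rewrite (Prop_irrelevance k h). Qed.

Lemma stalk_res_comp i x y z e : le x y -> le y z ->
  stalk_res i y z (stalk_res i x y e) = stalk_res i x z e.
Proof.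
move=> xy yz; have xz := bar_le_trans xy yz.
rewrite (stalk_resE (le_sub xy)) (stalk_resE (le_sub yz)) (stalk_resE (le_sub xz)).
exact: res_comp.
Qed.

Lemma stalk_res_diff i y z e :
  diff A i (N z) (stalk_res i y z e) = stalk_res (i + 1) y z (diff A i (N y) e).
Proof.
rewrite /stalk_res; case: pselect => [h|_] /=; last by rewrite linear0.
exact: hom_nat.
Qed.

(* All degrees of A are kept together and [bar_cond m] selects the cochains of
   total degree m, which avoids transports between A (i + 1 - p) and
   A (i - p + 1). *)
Definition bar_fun x : lmodType R :=
  dprod (fun c : seq T => graded A (N (last x c))).

Definition bar_cond m x : set (bar_fun x) :=
  [set g | forall c i, ~~ (path le x c && (i + (size c)%:Z == m)) -> g c i = 0].

Lemma bar_submodule m x : is_submodule (@bar_cond m x).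
Proof.
split=> [//|a s t s0 t0 c i nci].
by rewrite -[LHS]/(a *: s c i + t c i) s0 // t0 // scaler0 addr0.
Qed.

Definition bar_sheaf m : sheaf R U :=
  prod_sheaf U (fun x => submodule (bar_submodule m x)).

Lemma bar_sheaf_injective m : injective_sheaf (bar_sheaf m).
Proof. exact: prod_sheaf_injective N_mem N_min. Qed.

(** Extension by 0 to all points lets [bar_d] evaluate a section at any point without a proof of
    membership in [V]. Chains starting in [V] stay in [V], so the added values do not affect the
    result there. *)
Definition bar_ext m V (t : bar_sheaf m V) x : bar_fun x :=
  if pselect (subopen_set V x) is left p then val (t (exist _ x p)) else 0.

Lemma bar_ext_in m V (t : bar_sheaf m V) x p : bar_ext t x = val (t (exist _ x p)).
Proof. by rewrite /bar_ext; case: pselect => // q; rewrite (Prop_irrelevance q p). Qed.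

Lemma bar_ext_cond m V (t : bar_sheaf m V) x : bar_cond m (bar_ext t x).
Proof.
by rewrite /bar_ext; case: pselect => // p; exact: submoduleP.
Qed.

Lemma bar_ext_linear m V a (s t : bar_sheaf m V) x :
  bar_ext (a *: s + t) x = a *: bar_ext s x + bar_ext t x.
Proof.
rewrite /bar_ext; case: pselect => [p|_]; last by rewrite scaler0 addr0.
by rewrite -linearP.
Qed.

Lemma bar_ext_res m V W (h : W `<=` V) (t : bar_sheaf m V) x :
  subopen_set W x -> bar_ext (res _ h t) x = bar_ext t x.
Proof.
move=> Wx; rewrite (bar_ext_in _ Wx) (bar_ext_in _ (h _ Wx)) /=.
by [].
Qed.

Definition sgn (m : int) : R := (-1) ^ m.

Lemma sgnS m : sgn (m + 1) = - sgn m.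
Proof. by rewrite /sgn exprzDr ?unitrN1 // expr1z mulrN1. Qed.

Lemma sgn_sqr m : sgn m * sgn m = 1.
Proof.
by rewrite /sgn -expfzMl mulrNN mulr1 exp1rz.
Qed.

(* The internal and the face differential commute, so a sign depending only on
   the total degree makes the square of the sum vanish. *)
Definition bar_d m (g : forall x, bar_fun x) x : bar_fun x := fun c j =>
  graded_diff (g x c) j + sgn m *: face_diff le (stalk_res j) (fun=> 0) (fun y d => g y d j) x c.

Lemma bar_d_cond m (g : forall x, bar_fun x) x :
  (forall y, bar_cond m (g y)) -> bar_cond (m + 1) (bar_d m g x).
Proof.
move=> gm c j ncj; rewrite /bar_d.
have -> : graded_diff (g x c) j = 0.
  elim/int_succ: j ncj => j ncj; rewrite graded_diffE gm ?linear0 //.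
  by apply: contra ncj => /andP[-> /eqP <-]; rewrite /= addrAC.
rewrite add0r; have [px|npx] := boolP (path le x c); last first.
  rewrite face_diff_support ?scaler0 // => w d nwd; apply: gm.
  by rewrite negb_and nwd.
rewrite face_diff_eq0 ?scaler0 // => w d dc; apply: gm.
rewrite negb_and orbC; apply/orP; left; apply: contra ncj => /eqP <-.
by rewrite px /= -dc -addn1 PoszD addrA.
Qed.

Definition bar_diff_fun m V (t : bar_sheaf m V) : bar_sheaf (m + 1) V :=
  fun x => to_submodule (bar_submodule (m + 1) (sval x))
    (@bar_d_cond m (bar_ext t) (sval x) (@bar_ext_cond m V t)).

Lemma bar_ext_diff m V (t : bar_sheaf m V) x : subopen_set V x ->
  bar_ext (bar_diff_fun t) x = bar_d m (bar_ext t) x.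
Proof. by move=> Vx; rewrite (bar_ext_in _ Vx). Qed.

Lemma bar_secP m V (s t : bar_sheaf m V) :
  (forall x, subopen_set V x -> forall c i, bar_ext s x c i = bar_ext t x c i) ->
  s = t.
Proof.
move=> st; apply: functional_extensionality_dep => -[x Vx].
apply: val_inj; rewrite -!bar_ext_in.
by apply: functional_extensionality_dep => c; apply: functional_extensionality_dep => i; exact: st.
Qed.

Lemma bar_diff_linear m V : linear (@bar_diff_fun m V).
Proof.
move=> a s t; apply: bar_secP => x Vx c j.
rewrite bar_ext_linear !bar_ext_diff //.
rewrite -[RHS]/(a *: bar_d m (bar_ext s) x c j + bar_d m (bar_ext t) x c j) /bar_d.
rewrite scalerDr addrACA scalerA (mulrC a) -scalerA -scalerDr -face_diffP bar_ext_linear.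
rewrite -[graded_diff _ j]/((graded_diff (a *: bar_ext s x c + bar_ext t x c) : graded A _) j).
rewrite graded_diff_linear.
congr (_ + _ *: face_diff _ _ _ _ _ _).
  by apply: functional_extensionality_dep => w; rewrite scaler0 addr0.
apply: functional_extensionality_dep => w; apply: functional_extensionality_dep => d.
by rewrite bar_ext_linear.
Qed.

Lemma bar_diff_nat m V W (h : W `<=` V) (t : bar_sheaf m V) :
  bar_diff_fun (res _ h t) = res _ h (bar_diff_fun t).
Proof.
apply: bar_secP => x Wx c j; rewrite bar_ext_res // !bar_ext_diff //; last exact: h.
rewrite /bar_d bar_ext_res //; congr (_ + _ *: _).
apply: (@face_diff_ext _ _ _ _ _ (subopen_set W)) => // [w z|w d Ww]; first exact: le_upclosed.
by rewrite bar_ext_res.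
Qed.

Definition bar_diff m : hom (bar_sheaf m) (bar_sheaf (m + 1)) :=
  hom_of (@bar_diff_linear m) (@bar_diff_nat m).

Lemma bar_diff_diff m V (t : bar_sheaf m V) : bar_diff (m + 1) V (bar_diff m V t) = 0.
Proof.
apply: bar_secP => x Vx c j; rewrite [RHS](_ : _ = 0); last first.
  by rewrite (bar_ext_in _ Vx).
rewrite bar_ext_diff // /bar_d sgnS.
elim/int_succ: j => j; pose g := bar_ext t.
(* Over [V] the inner cochain is a linear combination of a face differential and an internal
   differential, which [face_diffP] separates. *)
rewrite (@face_diff_ext _ _ _ _ _ (subopen_set V) _ (fun=> sgn m *: 0 + 0) _
  (fun y d => sgn m *: face_diff le (stalk_res (j + 1)) (fun=> 0)
     (fun y d => g y d (j + 1)) y d + diff A j _ (g y d j))) //; first last.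
- by move=> y d Vy; rewrite bar_ext_diff // /bar_d graded_diffE; exact: addrC.
- by move=> w _; rewrite scaler0 addr0.
- by move=> w z; exact: le_upclosed.
rewrite face_diffP face_diff_face_diff; first last.
- by move=> w _; rewrite linear0.
- exact: stalk_res_comp.
- exact: bar_le_trans.
rewrite scaler0 add0r graded_diffE bar_ext_diff // /bar_d linearD linearZ.
elim/int_succ: j => j; rewrite graded_diffE diff_diff add0r.
rewrite (@face_diff_morph _ _ le _ (stalk_res (j + 1)) _ (stalk_res (j + 1 + 1))
  (fun y => diff A (j + 1) (N y))); last exact: stalk_res_diff.
rewrite (_ : (fun w => diff A (j + 1) (N w) 0) = fun=> 0); last first.
  by apply: functional_extensionality_dep => w; rewrite linear0.
by rewrite scaleNr; exact: subrr.
Qed.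

Lemma bar_bounded : exists n : int, forall i : int, i < n ->
  is_zero_sheaf (bar_sheaf i).
Proof.
have [n An] := bounded_below A; exists n => m mn V t; apply: bar_secP => x Vx c i.
rewrite [RHS](_ : _ = 0); last by rewrite (bar_ext_in _ Vx).
have [im|im] := eqVneq (i + (size c)%:Z) m; last first.
  by apply: bar_ext_cond; rewrite negb_and im orbT.
by apply: An; apply: le_lt_trans mn; rewrite -im lerDl.
Qed.

Definition bar_complex : complex R U := Complex bar_diff_diff bar_bounded.

Definition unit_fun m x (s : A m (N x)) : bar_fun x := fun c =>
  if c is [::] as c return graded A (N (last x c)) then single s else 0.

Lemma unit_fun_cond m x (s : A m (N x)) : bar_cond m (unit_fun s).
Proof.
move=> [|z c] i //= nim; apply: single_neq; apply: contra nim => /eqP ->.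
by rewrite addr0.
Qed.

Definition bar_unit_fun m V (s : A m V) : bar_sheaf m V := fun x =>
  to_submodule (bar_submodule m (sval x))
    (@unit_fun_cond m (sval x) (res (A m) (N_min (svalP x)) s)).

Lemma bar_ext_unit m V (s : A m V) x (Vx : subopen_set V x) :
  bar_ext (bar_unit_fun s) x = unit_fun (res (A m) (N_min Vx) s).
Proof.
rewrite (bar_ext_in _ Vx) /=; congr (unit_fun (res _ _ _)); exact: Prop_irrelevance.
Qed.

Lemma bar_unit_linear m V : linear (@bar_unit_fun m V).
Proof.
move=> a s t; apply: bar_secP => x Vx c i; rewrite bar_ext_linear !(bar_ext_unit _ Vx).
rewrite -[RHS]/(a *: unit_fun (res (A m) (N_min Vx) s) c i +
  unit_fun (res (A m) (N_min Vx) t) c i) linearP.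
case: c => [|z c] /=; first by rewrite single_linear.
by rewrite -[RHS]/(a *: 0 + 0) scaler0 addr0.
Qed.

Lemma bar_unit_nat m V W (h : W `<=` V) (s : A m V) :
  bar_unit_fun (res _ h s) = res _ h (bar_unit_fun s).
Proof.
apply: bar_secP => x Wx c i; rewrite bar_ext_res //.
by rewrite (bar_ext_unit _ Wx) (bar_ext_unit _ (h _ Wx)) (res_comp _ _ (N_min (h _ Wx))).
Qed.

Definition bar_unit_hom m : hom (A m) (bar_sheaf m) :=
  hom_of (@bar_unit_linear m) (@bar_unit_nat m).

(** On a one-point chain only the internal differential contributes. On a chain of two points x, z
    both faces give the restriction of [s] to [N z] and cancel; longer chains give 0. *)
Lemma bar_unit_diff m V (s : A m V) :
  bar_unit_hom (m + 1) V (diff A m V s) = bar_diff m V (bar_unit_hom m V s).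
Proof.
apply: bar_secP => x Vx c j; rewrite bar_ext_diff // (bar_ext_unit _ Vx) /bar_d.
have zero e k : graded_diff (0 : graded A e) k = 0.
  by elim/int_succ: k => k; rewrite graded_diffE linear0.
rewrite -hom_nat; case: c => [|z c] /=.
  by rewrite (bar_ext_unit _ Vx) /= scaler0 addr0 graded_diff_single.
rewrite (bar_ext_unit _ Vx) /= zero add0r; case: ifP => [xz|_]; last by rewrite scaler0.
have Vz := le_upclosed Vx xz; rewrite (bar_ext_unit _ Vz).
case: c => [|w c]; last by rewrite face_diff_eq0 // subr0 scaler0.
rewrite /=.
have [<-|ne] := eqVneq m j; last by rewrite !single_neq // linear0 subr0 scaler0.
by rewrite !single_id (stalk_resE (le_sub xz)) (res_comp _ _ (N_min Vz)) subrr scaler0.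
Qed.

Definition bar_unit : cmap A bar_complex :=
  @CMap _ _ _ A bar_complex bar_unit_hom bar_unit_diff.

Lemma bar_extB m V (s t : bar_sheaf m V) x c i :
  bar_ext (s - t) x c i = bar_ext s x c i - bar_ext t x c i.
Proof.
rewrite -scaleN1r addrC bar_ext_linear scaleN1r.
by rewrite -[LHS]/(- bar_ext t x c i + bar_ext s x c i) addrC.
Qed.

Lemma bar_ext0 m V x c i : bar_ext (0 : bar_sheaf m V) x c i = 0.
Proof. by rewrite /bar_ext; case: pselect. Qed.

(** The usual contraction of a bar construction over [N x]: prepend x to every chain. The sign
    offsets that of the face differential in [bar_d]. *)
Definition bar_contract m x (g : bar_fun x) y : bar_fun y :=
  fun c j => sgn (m + 1) *: g (y :: c) j.

Lemma bar_contract_cond m x (g : bar_fun x) y :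
  bar_cond (m + 1) g -> bar_cond m (bar_contract m g y).
Proof.
move=> gm c j ncj; rewrite /bar_contract gm ?scaler0 //=.
apply: contra ncj => /andP[/andP[_ ->]].
by rewrite -addn1 PoszD addrA => /eqP/addIr ->; rewrite eqxx.
Qed.

(** Evaluation at the one-point chain x inverts the unit on the left, which gives injectivity on
    stalks. For surjectivity, on [N x] a cocycle [t] differs from the unit of its value at that
    chain by the boundary of its contraction. *)
Lemma bar_unit_quasi_iso : quasi_iso bar_unit.
Proof.
move=> i x Ux; split=> [s t [W [hs [ht [u [Wx e]]]]]|t].
  exists (N x), (N_min (hs _ Wx)), (N_min (ht _ Wx)), (bar_ext u x [::] i).
  split; first exact: N_mem.
  have /= := congr1 (fun t : bar_sheaf (i + 1) W => bar_ext t x [::] (i + 1)) e.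
  rewrite bar_ext_diff // bar_extB !bar_ext_res //.
  rewrite (bar_ext_unit _ (hs _ Wx)) (bar_ext_unit _ (ht _ Wx)) /bar_d /= !single_id.
  by rewrite scaler0 addr0 graded_diffE => <-.
have Vx := cc_mem t; pose g := bar_ext (cc_sec t).
have Dt y c j : subopen_set (cc_dom t) y -> bar_d (i + 1) g y c j = 0.
  move=> Vy; rewrite -bar_ext_diff //.
  by have := cc_diff t; rewrite /= => ->; exact: bar_ext0.
have ds : diff A (i + 1) (N x) (g x [::] (i + 1)) = 0.
  by have := Dt x [::] (i + 1 + 1) Vx; rewrite /bar_d /= scaler0 addr0 graded_diffE.
pose s := Cocycle (N_mem Ux) ds; exists s.
pose u : bar_sheaf i (N x) := fun y => to_submodule (bar_submodule i (sval y))
    (@bar_contract_cond i x (g x) (sval y) (@bar_ext_cond (i + 1) _ _ x)).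
exists (N x), (@subset_refl _ _), (N_min Vx), u; split; first exact: N_mem.
apply: bar_secP => y Ny c j.
rewrite bar_extB bar_ext_diff // bar_ext_res // bar_ext_res; last exact: Ny.
rewrite (bar_ext_unit _ Ny).
have extu w : subopen_set (N x) w -> bar_ext u w = bar_contract i (g x) w.
  by move=> Nw; rewrite (bar_ext_in _ Nw).
have xy : le x y by apply/asboolP.
(* The cocycle equation on the chain x, y, c expresses the internal differential of the contraction
   by face differentials. *)
have := Dt x (y :: c) j Vx; rewrite /bar_d extu //.
rewrite (_ : graded_diff (bar_contract i (g x) y c) j =
    sgn (i + 1) *: graded_diff (g x (y :: c)) j); last first.
  by elim/int_succ: j => j; rewrite !graded_diffE linearZ.
move=> /(canRL (addrK _)) ->; rewrite sub0r scalerN scalerA sgn_sqr scale1r.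
rewrite [face_diff _ _ _ _ x _]/= xy opprB.
rewrite [X in _ + _ *: X](@face_diff_ext _ _ _ _ _ (subopen_set (N x)) _
  (fun=> sgn (i + 1) *: 0 + 0) _ (fun w d => sgn (i + 1) *: g x (w :: d) j + 0)) //; first last.
- by move=> w d Nw; rewrite extu // addr0.
- by move=> w _; rewrite scaler0 addr0.
- by move=> w z; exact: le_upclosed.
rewrite face_diffP [face_diff _ _ _ (fun _ _ => 0) _ _]face_diff_eq0 // addr0.
rewrite scalerA sgnS mulrN sgn_sqr scaleN1r.
rewrite [RHS]addrAC; congr (_ - _); case: c => [|z c].
  rewrite subr0 /=; have [<-|ne] := eqVneq (i + 1) j.
    by rewrite single_id (stalk_resE (le_sub xy)); congr (res _ _ _); exact: Prop_irrelevance.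
  rewrite single_neq // /g bar_ext_cond ?linear0 //=.
  by rewrite addr0 eq_sym.
by rewrite /= subrr.
Qed.

Lemma bar_injective_resolution : exists I, injective_resolution A I.
Proof.
exists bar_complex; split; first by exists bar_unit; exact: bar_unit_quasi_iso.
exact: bar_sheaf_injective.
Qed.

End BarResolution.

(** * Maps into complexes of injectives *)

Section SumSheaf.
Context (R : realType) (T : topologicalType) (U : opens T) (F G : sheaf R U).

Definition sum_sec (V : subopen U) : lmodType R := (F V * G V)%type.

Section Res.
Context (V W : subopen U) (h : W `<=` V).

Definition sum_res_fun (s : sum_sec V) : sum_sec W := (res F h s.1, res G h s.2).

Lemma sum_res_linear : linear sum_res_fun.
Proof.
move=> a s t; rewrite /sum_res_fun /=.
by rewrite -[RHS]/(a *: res F h s.1 + res F h t.1, a *: res G h s.2 + res G h t.2) !linearP.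
Qed.

Definition sum_res : {linear sum_sec V -> sum_sec W} := lin_of sum_res_linear.

End Res.

Lemma sum_res_id (V : subopen U) (k : V `<=` V) (s : sum_sec V) : sum_res k s = s.
Proof. by case: s => a b; rewrite /= /sum_res_fun !res_id. Qed.

Lemma sum_res_comp (V W Z : subopen U) (k : W `<=` V) (k' : Z `<=` W)
    (k'' : Z `<=` V) (s : sum_sec V) : sum_res k' (sum_res k s) = sum_res k'' s.
Proof. by rewrite /= /sum_res_fun !(res_comp k k' k''). Qed.

Lemma sum_sep (V : subopen U) (J : Type) (W : J -> subopen U)
    (c : forall j, W j `<=` V) : V `<=` \bigcup_j W j ->
  forall s t : sum_sec V, (forall j, sum_res (c j) s = sum_res (c j) t) -> s = t.
Proof.
move=> cov [a b] [a' b'] st; congr (_, _).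
  by apply: (sheaf_sep cov (c := c)) => j; have [] := st j.
by apply: (sheaf_sep cov (c := c)) => j; have [] := st j.
Qed.

Lemma sum_glue (V : subopen U) (J : Type) (W : J -> subopen U)
    (c : forall j, W j `<=` V) : V `<=` \bigcup_j W j ->
  forall s : forall j, sum_sec (W j),
  (forall i j,
    sum_res (@subIsetl _ (W i) (W j) : subopenI (W i) (W j) `<=` W i) (s i) =
    sum_res (@subIsetr _ (W i) (W j) : subopenI (W i) (W j) `<=` W j) (s j)) ->
  exists t : sum_sec V, forall j, sum_res (c j) t = s j.
Proof.
move=> cov s comp.
have [|a aP] := sheaf_glue c cov (s := fun j => (s j).1).
  by move=> i j; have [] := comp i j.
have [|b bP] := sheaf_glue c cov (s := fun j => (s j).2).
  by move=> i j; have [] := comp i j.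
by exists (a, b) => j; rewrite /= /sum_res_fun aP bP; case: (s j).
Qed.

Definition sum_sheaf : sheaf R U := Sheaf sum_res_id sum_res_comp sum_sep sum_glue.

End SumSheaf.

(** * Factorization through image sheaves *)

Section InjectiveFactor.
Context (R : realType) (T : topologicalType) (U : opens T) (F G J : sheaf R U).
Context (e : hom F G) (f : hom F J).
Implicit Types V W : subopen U.

Definition image_cond V : set (G V) := [set t | forall x, subopen_set V x ->
  exists (W : subopen U) (h : W `<=` V) (s : F W), subopen_set W x /\ e W s = res G h t].

Lemma image_submodule V : is_submodule (@image_cond V).
Proof.
split=> [x Vx|a t t' It It' x Vx].
  by exists V, (@subset_refl _ _), 0; split=> //; rewrite !linear0.
have [W [h [s [Wx es]]]] := It x Vx; have [W' [h' [s' [W'x es']]]] := It' x Vx.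
pose Z := subopenI W W'; have hW : Z `<=` W by move=> y [].
have hW' : Z `<=` W' by move=> y [].
have hV : Z `<=` V by move=> y /hW /h.
exists Z, hV, (a *: res F hW s + res F hW' s'); split=> //.
by rewrite !linearP !hom_nat es es' (res_comp _ _ hV) (res_comp _ _ hV).
Qed.

Lemma image_res V W (h : W `<=` V) (t : G V) : image_cond t -> image_cond (res G h t).
Proof.
move=> It x Wx; have [Z [k [s [Zx es]]]] := It x (h _ Wx).
have hZ : subopenI Z W `<=` Z by move=> y [].
have hW : subopenI Z W `<=` W by move=> y [].
have hV : subopenI Z W `<=` V by move=> y /hW /h.
exists (subopenI Z W), hW, (res F hZ s); split=> //.
by rewrite hom_nat es (res_comp _ _ hV) (res_comp _ _ hV).
Qed.

Lemma image_local V (I : Type) (W : I -> subopen U) (c : forall i, W i `<=` V) :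
  V `<=` \bigcup_i W i ->
  forall t : G V, (forall i, image_cond (res G (c i) t)) -> image_cond t.
Proof.
move=> cov t It x Vx; have [i _ Wx] := cov _ Vx.
have [Z [h [s [Zx es]]]] := It i x Wx.
have hV : Z `<=` V by move=> y /h /(c i).
by exists Z, hV, s; split=> //; rewrite es (res_comp _ _ hV).
Qed.

Definition image_sheaf : sheaf R U :=
  subsheaf (LocalCondition image_submodule image_res image_local).

Hypothesis f0 : forall V (s : F V), e V s = 0 -> f V s = 0.

(** Quantifying over all local preimages of [t] avoids choosing any: [v] is then unique, and
    linearity and naturality of [fbar] follow from uniqueness. *)
Let agrees V (t : G V) (v : J V) : Prop :=
  forall W (h : W `<=` V) (s : F W), e W s = res G h t -> f W s = res J h v.

Let local_lift V (t : G V) : Type :=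
  {W : subopen U & {h : W `<=` V & {s : F W | e W s = res G h t}}}.

Lemma local_lift_cover V (t : G V) : image_cond t ->
  V `<=` \bigcup_(l : local_lift t) projT1 l.
Proof.
move=> It x /It[W [h [s [Wx es]]]].
by exists (existT _ W (existT _ h (exist _ s es))).
Qed.

Lemma agrees_unique V (t : G V) (v v' : J V) : image_cond t ->
  agrees t v -> agrees t v' -> v = v'.
Proof.
move=> /local_lift_cover cov av av'.
apply: (sheaf_sep cov (c := fun l => projT1 (projT2 l))) => -[W [h [s es]]] /=.
by rewrite -(av _ _ _ es) -(av' _ _ _ es).
Qed.

Lemma agrees_exists V (t : G V) : image_cond t -> exists v, agrees t v.
Proof.
move=> It; have cov := local_lift_cover It.
have f_eq W W' (h : W `<=` V) (h' : W' `<=` V) (Z : subopen U) (k : Z `<=` W)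
      (k' : Z `<=` W') s s' :
    e W s = res G h t -> e W' s' = res G h' t ->
    res J k (f W s) = res J k' (f W' s').
  move=> es es'; apply/subr0_eq; rewrite -!hom_nat -linearB f0 //.
  have hV : Z `<=` V by move=> x /k /h.
  by rewrite linearB !hom_nat es es' (res_comp _ _ hV) (res_comp _ _ hV) subrr.
have [|v vP] := sheaf_glue (fun l : local_lift t => projT1 (projT2 l)) cov
    (s := fun l => f _ (sval (projT2 (projT2 l)))).
  by move=> [W [h [s es]]] [W' [h' [s' es']]] /=; exact: f_eq es es'.
exists v => W h s es.
have := vP (existT _ W (existT _ h (exist _ s es))).
by move=> /= ->.
Qed.

Let lift_image V (t : image_sheaf V) : {v : J V | agrees (val t) v} :=
  cid (agrees_exists (submoduleP t)).

Let fbar V (t : image_sheaf V) : J V := sval (lift_image t).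

Lemma fbarP V (t : image_sheaf V) : agrees (val t) (fbar t).
Proof. exact: svalP (lift_image t). Qed.

Lemma fbar_linear V : linear (@fbar V).
Proof.
move=> a t t'; apply: (agrees_unique (submoduleP (a *: t + t'))); first exact: fbarP.
move=> W h s es.
apply: (sheaf_sep (local_lift_cover (image_res h (submoduleP t)))
  (c := fun l => projT1 (projT2 l))) => -[Z [k [u eu]]] /=.
have kV : Z `<=` V by move=> x /k /h.
rewrite (res_comp _ _ kV) linearP.
have eu' : e Z u = res G kV (val t) by rewrite eu (res_comp _ _ kV).
rewrite -(fbarP eu') -hom_nat.
(* Subtracting [a] times a local preimage of [t] from a preimage of the sum leaves a preimage of
   [t']. *)
have es' : e Z (res F k s - a *: u) = res G kV (val t').
  rewrite linearB linearZ hom_nat es eu' (res_comp _ _ kV).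
  by rewrite (_ : val (a *: t + t') = a *: val t + val t') // linearP addrAC subrr add0r.
by rewrite -(fbarP es') -linearP addrC subrK.
Qed.

Lemma fbar_nat V W (h : W `<=` V) (t : image_sheaf V) :
  fbar (res _ h t) = res J h (fbar t).
Proof.
apply: (agrees_unique (submoduleP (res _ h t))); first exact: fbarP.
move=> Z k s es; have hV : Z `<=` V by move=> x /k /h.
rewrite (res_comp _ _ hV); apply: fbarP.
by rewrite es /= (res_comp _ _ hV).
Qed.

Lemma image_inc_nat V W (h : W `<=` V) (t : image_sheaf V) :
  val (res _ h t) = res G h (val t).
Proof. by []. Qed.

(** By [f0] the map [f] vanishes on the kernel of [e], so it descends to the image sheaf of [e];
    injectivity of [J] extends it from there to [G]. *)
Lemma injective_factor : injective_sheaf J ->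
  exists g : hom G J, forall V (s : F V), g V (e V s) = f V s.
Proof.
move=> injJ.
have inc_linear V : linear (fun t : image_sheaf V => val t : G V) by [].
have [|g gP] := injJ image_sheaf G (hom_of inc_linear image_inc_nat)
  (hom_of fbar_linear fbar_nat).
  by move=> V s t /val_inj.
exists g => V s.
have Is : image_cond (e V s).
  by move=> x Vx; exists V, (@subset_refl _ _), s; rewrite res_id.
have := gP V (to_submodule (image_submodule V) Is); rewrite /= => ->.
have := @fbarP V (to_submodule (image_submodule V) Is) V (@subset_refl _ _) s.
by rewrite !res_id => ->.
Qed.

End InjectiveFactor.

(** * Null homotopies into complexes of injectives *)

Section IntChoice.
Context (H : int -> Type) (P : forall i, H i -> H (i + 1) -> Prop).
Context (z : forall i, H i) (n : int).
Hypothesis Pz : forall i, i < n -> P (z i) (z (i + 1)).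
Hypothesis Pstep : forall i a b, @P i a b -> exists c, P b c.

Let state : Type := {i : int & {a : H i & {b : H (i + 1) | P a b}}}.

Let step (s : state) : state :=
  let: existT i (existT a (exist b ab)) := s in
  let: exist c bc := cid (Pstep ab) in
  existT _ (i + 1) (existT _ b (exist _ c bc)).

(** A choice is possible only once the preceding relation is known, so the iterated state carries
    its degree, two consecutive values and their relation. The iteration starts at n - 1, the last
    degree in which [Pz] applies; below it [z] is kept. *)
Lemma int_dependent_choice : exists h : forall i, H i, forall i, P (h i) (h (i + 1)).
Proof.
have lt0 : n - 1 < n by rewrite ltrBlDr ltrDl.
pose s0 : state := existT _ (n - 1) (existT _ (z (n - 1)) (exist _ _ (Pz lt0))).
pose st k := iter k step s0.
have tag_st k : projT1 (st k) = n - 1 + k%:Z.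
  elim: k => [|k IH] /=; first by rewrite addr0.
  rewrite -addn1 PoszD addrA -IH /step.
  by case: (st k) => i [a [b ab]]; case: cid.
pose idx (i : int) := absz (i - (n - 1))%R.
pose cast (s : state) i (e : projT1 s = i) : H i := eq_rect _ H (projT1 (projT2 s)) i e.
pose h i := if pselect (projT1 (st (idx i)) = i) is left e then cast _ _ e else z i.
have h_ge i e : h i = cast (st (idx i)) i e.
  by rewrite /h; case: pselect => // e'; rewrite (Prop_irrelevance e' e).
have h_lt i : i < n - 1 -> h i = z i.
  move=> lt_in; rewrite /h; case: pselect => // e; exfalso.
  by move: e; rewrite tag_st /idx; lia.
have tag_idx i : n - 1 <= i -> projT1 (st (idx i)) = i.
  by move=> le_ni; rewrite tag_st /idx; lia.
have cast_step s i (e : projT1 s = i) (e' : projT1 (step s) = i + 1) :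
    P (cast s i e) (cast (step s) (i + 1) e').
  case: s e e' => j [a [b ab]] /= e; case: _ / e; case: cid => c bc /= e'.
  by rewrite (Prop_irrelevance e' erefl).
exists h => i; have [le_ni|lt_in] := leP (n - 1) i.
  have e := tag_idx _ le_ni.
  have e' : projT1 (st (idx (i + 1))) = i + 1 by apply: tag_idx; lia.
  rewrite (h_ge _ e) (h_ge _ e'); move: e'.
  have -> : idx (i + 1) = (idx i).+1 by rewrite /idx; lia.
  exact: cast_step.
rewrite h_lt //; suff -> : h (i + 1) = z (i + 1) by apply: Pz; lia.
have [?|ni] := ltP (i + 1) (n - 1); first exact: h_lt.
rewrite (h_ge _ (tag_idx _ ni)); move: (tag_idx _ ni).
have -> : idx (i + 1) = 0%N by rewrite /idx; lia.
by move=> /= e; rewrite /cast /=; case: _ / e.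
Qed.

End IntChoice.

Section NullHomotopy.
Context (R : realType) (T : topologicalType) (U : opens T).
Implicit Types V W : subopen U.
Context (C : int -> sheaf R U) (e : forall i, hom (C i) (C (i + 1))).
Context (I : complex R U) (f : forall i, hom (C i) (I (i + 1))).
Hypothesis injI : forall i, injective_sheaf (I i).
Hypothesis exact_e : forall i V (s : C (i + 1) V), e (i + 1) V s = 0 ->
  forall x, subopen_set V x -> exists (W : subopen U) (h : W `<=` V) (u : C i W),
    subopen_set W x /\ res _ h s = e i W u.
Hypothesis f_comm : forall i V (s : C i V),
  diff I (i + 1) V (f i V s) = f (i + 1) V (e i V s).

(** The homotopy is built upwards from zero maps. What remains of [f] after subtracting the part
    already built kills the kernel of [e], whose sections are locally of the form [e u] by
    exactness, so it factors through [e] by [injective_factor]. *)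
Lemma null_homotopy : exists h : forall i, hom (C i) (I i), forall i V (s : C i V),
  f i V s = diff I i V (h i V s) + h (i + 1) V (e i V s).
Proof.
have [n In] := bounded_below I.
(* The bound is n - 1 because [f i] takes values in [I (i + 1)]. *)
apply: (@int_dependent_choice (fun i => hom (C i) (I i))
  (fun i a b => forall V (s : C i V), f i V s = diff I i V (a V s) + b V (e i V s))
  (fun i => zero_hom _ _) (n - 1)) => [i lt_in V s|i a b ab].
  by rewrite /= linear0 addr0; apply: In; rewrite -ltrBrDr.
pose g V (s : C (i + 1) V) := f (i + 1) V s - diff I (i + 1) V (b V s).
have g_linear V : linear (@g V).
  by move=> k s t; rewrite /g !linearP /= addrACA -scalerDr.
have g_nat V W (h : W `<=` V) s : @g W (res _ h s) = res _ h (g V s).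
  by rewrite /g linearB !hom_nat.
have [|c cP] := @injective_factor _ _ _ _ _ _ (e (i + 1)) (hom_of g_linear g_nat) _
    (@injI (i + 1 + 1)).
  move=> V s es0; rewrite /= -[LHS]/(g V s).
  have loc (x : {x | subopen_set V x}) : {W : subopen U & {h : W `<=` V & {u : C i W |
      subopen_set W (sval x) /\ res _ h s = e i W u}}}.
    have /cid[W /cid[h /cid[u P]]] := exact_e es0 (svalP x).
    by exists W, h, u.
  have cov : V `<=` \bigcup_x projT1 (loc x).
    move=> x Vx; exists (exist _ x Vx) => //.
    by case: (loc _) => W [h [u [Wx su]]].
  apply: (sheaf_sep cov (c := fun x => projT1 (projT2 (loc x)))) => x.
  case: (loc x) => W [h [u [Wx su]]] /=.
  rewrite linear0 -g_nat su /g -f_comm ab.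
  by rewrite linearD diff_diff add0r subrr.
by exists c => V s; rewrite cP /= /g [RHS]addrC subrK.
Qed.

End NullHomotopy.

(** * Mapping cones and lifting along quasi-isomorphisms *)

Section Cone.
Context (R : realType) (T : topologicalType) (U : opens T) (A B : complex R U).
Context (s : cmap A B).
Implicit Types V W : subopen U.

Definition cone_sheaf i : sheaf R U := sum_sheaf (A (i + 1)) (B i).

(** The differential of the mapping cone, with the sign on the component in [B] instead of the one
    in [A]. *)
Definition cone_fun i V (t : cone_sheaf i V) : cone_sheaf (i + 1) V :=
  (diff A (i + 1) V t.1, s (i + 1) V t.1 - diff B i V t.2).

Lemma cone_linear i V : linear (@cone_fun i V).
Proof.
move=> a t u; rewrite /cone_fun.
rewrite -[RHS]/(a *: diff A (i + 1) V t.1 + diff A (i + 1) V u.1,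
  a *: (s (i + 1) V t.1 - diff B i V t.2) + (s (i + 1) V u.1 - diff B i V u.2)).
rewrite -[(a *: t + u).1]/(a *: t.1 + u.1) -[(a *: t + u).2]/(a *: t.2 + u.2).
by rewrite !linearP /= addrACA -scalerDr.
Qed.

Lemma cone_nat i V W (h : W `<=` V) (t : cone_sheaf i V) :
  cone_fun (res _ h t) = res _ h (cone_fun t).
Proof.
by rewrite /cone_fun /= /sum_res_fun /= !hom_nat linearB -hom_nat.
Qed.

Definition cone_diff i : hom (cone_sheaf i) (cone_sheaf (i + 1)) :=
  hom_of (@cone_linear i) (@cone_nat i).

Hypothesis qs : quasi_iso s.

(** A cocycle (a, b) has s a = d b, so injectivity on cohomology gives a = d a' locally. Then s a' -
    b is a cocycle, and surjectivity one degree lower makes it cohomologous to some s c; replacing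
    a' by a' - c gives the primitive. *)
Lemma cone_exact i V (t : cone_sheaf (i + 1) V) : cone_diff (i + 1) V t = 0 ->
  forall x, subopen_set V x -> exists (W : subopen U) (h : W `<=` V) (u : cone_sheaf i W),
    subopen_set W x /\ res _ h t = cone_diff i W u.
Proof.
case: t => a b; rewrite /= /cone_fun /= => -[da sab] x Vx.
have Ux : opens_set U x by apply: subopen_sub Vx.
have [inj_s _] := qs (i + 1) Ux; have [_ surj_s] := qs i Ux.
pose ca : cocycle A (i + 1) x := Cocycle Vx da.
have zero_d : diff A (i + 1 + 1) V 0 = 0 by rewrite linear0.
have [|W [h [h' [a' [Wx e]]]]] := inj_s ca (Cocycle Vx zero_d).
  exists V, (@subset_refl _ _), (@subset_refl _ _), b; split=> //=.
  by rewrite !res_id linear0 subr0; apply/eqP; rewrite -subr_eq0 sab.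
rewrite /= linear0 subr0 in e.
have db : diff B (i + 1) W (s (i + 1) W a' - res _ h b) = 0.
  by rewrite linearB -cmap_diff -e !hom_nat -linearB sab linear0.
have [c [Z [k [k' [b' [Zx e']]]]]] := surj_s (Cocycle Wx db).
rewrite /= in k k' e'.
have kV : Z `<=` V by move=> y /k' /h.
exists Z, kV, (res _ k' a' - res _ k (cc_sec c), - b'); split=> //=.
rewrite /sum_res_fun /cone_fun /=; congr (_, _).
  rewrite linearB !hom_nat -e (res_comp _ _ kV).
  by rewrite cc_diff linear0 subr0.
rewrite linearN opprK -e' !linearB !hom_nat (res_comp _ _ kV).
by rewrite /= opprK addrA subrK addrA subrr add0r.
Qed.

End Cone.

Section HomAlgebra.
Context (R : realType) (T : topologicalType) (U : opens T) (F G J : sheaf R U).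

Definition opp_hom (f : hom F G) : hom F G.
Proof.
apply: (@hom_of _ _ _ F G (fun V s => - f V s)) => [V k a b|V W h a].
  by rewrite linearP opprD scalerN.
by rewrite hom_nat linearN.
Defined.

Definition add_hom (f g : hom F G) : hom F G.
Proof.
apply: (@hom_of _ _ _ F G (fun V s => f V s + g V s)) => [V k a b|V W h a].
  by rewrite !linearP /= addrACA -scalerDr.
by rewrite !hom_nat linearD.
Defined.

Definition sum_inl : hom F (sum_sheaf F G).
Proof.
apply: (@hom_of _ _ _ F (sum_sheaf F G) (fun V a => (a, 0))) => [V k a b|V W h a].
  by rewrite -[RHS]/(k *: a + b, k *: 0 + 0) scaler0 addr0.
by rewrite /= /sum_res_fun /= linear0.
Defined.

Definition sum_inr : hom G (sum_sheaf F G).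
Proof.
apply: (@hom_of _ _ _ G (sum_sheaf F G) (fun V a => (0, a))) => [V k a b|V W h a].
  by rewrite -[RHS]/(k *: 0 + 0, k *: a + b) scaler0 addr0.
by rewrite /= /sum_res_fun /= linear0.
Defined.

Definition sum_hom (f : hom F J) (g : hom G J) : hom (sum_sheaf F G) J.
Proof.
apply: (@hom_of _ _ _ (sum_sheaf F G) J (fun V s => f V s.1 + g V s.2)) => [V k a b|V W h a].
  rewrite -[(k *: a + b).1]/(k *: a.1 + b.1) -[(k *: a + b).2]/(k *: a.2 + b.2).
  by rewrite !linearP /= addrACA -scalerDr.
by rewrite /= !hom_nat linearD.
Defined.

Lemma sum_split (f : hom (sum_sheaf F G) J) V (a : F V) (b : G V) :
  f V (a, b) = f V (a, 0) + f V (0, b).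
Proof. by rewrite -linearD -[RHS]/(f V (a + 0, 0 + b)) addr0 add0r. Qed.

End HomAlgebra.

Section Lifting.
Context (R : realType) (T : topologicalType) (U : opens T) (A B I : complex R U).
Context (s : cmap A B).
Hypothesis qs : quasi_iso s.
Hypothesis injI : forall i, injective_sheaf (I i).
Implicit Types V W : subopen U.

(* A null homotopy of (a, b) |-> f a on the cone of s consists of a lift g and a
   homotopy from f to g o s. *)
Lemma quasi_iso_lift (f : cmap A I) : exists g : cmap B I, homotopic f (comp_cmap g s).
Proof.
pose phi i : hom (cone_sheaf A B i) (I (i + 1)) :=
  sum_hom (f (i + 1)) (zero_hom (B i) (I (i + 1))).
have [|h hP] := null_homotopy injI (cone_exact qs) (f := phi).
  by move=> i V t; rewrite /= !addr0 cmap_diff.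
pose g i := comp_hom (h i) (sum_inr (A (i + 1)) (B i)).
have g_diff i V b : g (i + 1) V (diff B i V b) = diff I i V (g i V b).
  have := hP i V (0, b); rewrite /= /cone_fun /= !linear0 addr0 sub0r.
  rewrite (_ : (0, - diff B i V b) = - (0, diff B i V b)); last first.
    by rewrite -[RHS]/(- 0, - diff B i V b) oppr0.
  by rewrite linearN => /esym/subr0_eq ->.
exists (CMap g_diff), (fun i => comp_hom (h i) (sum_inl (A (i + 1)) (B i))).
move=> i V a; have := hP i V (a, 0); rewrite /= addr0 /cone_fun /= linear0 subr0 => ->.
by rewrite (sum_split (h (i + 1))) -addrA addrK addrC.
Qed.

(* A homotopy k from f o s to g o s makes (a, b) |-> f b - g b - k a a map on the
   cone of s; its null homotopy restricts to one of f - g. *)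
Lemma quasi_iso_inj (f g : cmap B I) :
  homotopic (comp_cmap f s) (comp_cmap g s) -> homotopic f g.
Proof.
move=> [k kP].
pose phi i : hom (cone_sheaf A B (i + 1)) (I (i + 1)) :=
  sum_hom (opp_hom (k (i + 1))) (add_hom (f (i + 1)) (opp_hom (g (i + 1)))).
(* The negated differential is the one with which [phi] commutes. The shift by 1 reflects that a
   homotopy is indexed by its target degree. *)
have [||h hP] := null_homotopy (C := fun i => cone_sheaf A B (i + 1))
    (e := fun i => opp_hom (cone_diff s (i + 1))) injI _ (f := phi).
- move=> i V t et x Vx.
  have [|W [h [u [Wx e]]]] := cone_exact qs (t := t) _ Vx.
    by apply/eqP; rewrite -oppr_eq0; apply/eqP.
  by exists W, h, (- u); split=> //; rewrite e -[RHS]/(- cone_diff s (i + 1) W (- u)) linearN opprK.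
- move=> i V [a b] /=; have e := kP (i + 1) V a.
  rewrite linearD linearN linearB -!cmap_diff.
  rewrite linearN opprK opprB [f _ V (_ - _)]linearB [g _ V (_ - _)]linearB.
  have swap (V0 : zmodType) (x y z t : V0) : x - y - (z - t) = x - z - (y - t).
    by rewrite !opprB (addrC t) (addrC t) addrACA.
  have {}e : f (i + 1 + 1) V (s (i + 1 + 1) V a) - g (i + 1 + 1) V (s (i + 1 + 1) V a) =
    diff I (i + 1) V (k (i + 1) V a) + k (i + 1 + 1) V (diff A (i + 1 + 1) V a) := e.
  rewrite [X in _ = _ + X]swap e opprD.
  by rewrite [RHS]addrCA (addrCA (k _ _ _)) subrr addr0 addrC.
exists (fun i => comp_hom (h i) (sum_inr (A (i + 1 + 1)) (B (i + 1)))) => i V b.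
have := hP i V (0, b); rewrite /= linear0 oppr0 add0r => ->; congr (_ + _).
rewrite /cone_fun /= !linear0 sub0r; congr (h (i + 1) V _); apply: oppr_inj.
by rewrite opprK -[RHS]/(- 0, - _) oppr0.
Qed.

End Lifting.

(** * Derived isomorphisms *)

Section Homotopy.
Context (R : realType) (T : topologicalType) (U : opens T).
Implicit Types A B C I J : complex R U.

Lemma homotopic_ext A B (f g : cmap A B) :
  (forall i V s, f i V s = g i V s) -> homotopic f g.
Proof.
move=> fg; exists (fun i => zero_hom _ _) => i V s.
by rewrite fg subrr /= linear0 addr0.
Qed.

Lemma homotopic_refl A B (f : cmap A B) : homotopic f f.
Proof. exact: homotopic_ext. Qed.

Lemma homotopic_sym A B (f g : cmap A B) : homotopic f g -> homotopic g f.
Proof.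
move=> [h hP]; exists (fun i => opp_hom (h i)) => i V s.
by rewrite -opprB hP opprD /= linearN.
Qed.

Lemma homotopic_trans A B (f g k : cmap A B) :
  homotopic f g -> homotopic g k -> homotopic f k.
Proof.
move=> [h hP] [h' hP']; exists (fun i => add_hom (h i) (h' i)) => i V s.
by rewrite /= linearD addrACA -hP -hP' addrA subrK.
Qed.

Lemma homotopic_compl A B C (k : cmap B C) (f g : cmap A B) :
  homotopic f g -> homotopic (comp_cmap k f) (comp_cmap k g).
Proof.
move=> [h hP]; exists (fun i => comp_hom (k i) (h i)) => i V s.
by rewrite /= -linearB hP linearD cmap_diff.
Qed.

Lemma homotopic_compr A B C (f g : cmap B C) (k : cmap A B) :
  homotopic f g -> homotopic (comp_cmap f k) (comp_cmap g k).
Proof.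
move=> [h hP]; exists (fun i => comp_hom (h i) (k (i + 1))) => i V s.
by rewrite /= hP cmap_diff.
Qed.

Definition homotopy_equivalent A B : Prop :=
  exists (f : cmap A B) (g : cmap B A),
    homotopic (comp_cmap g f) (id_cmap A) /\ homotopic (comp_cmap f g) (id_cmap B).

Lemma homotopy_equivalent_D_iso A B : homotopy_equivalent A B -> D_iso A B.
Proof.
move=> [f [g [gf fg]]]; exists (DMap f), (DMap g); split.
  exact: dmor_trans (dmor_sym (dmor_map_comp g f)) (dmor_homotopic gf).
exact: dmor_trans (dmor_sym (dmor_map_comp f g)) (dmor_homotopic fg).
Qed.

Lemma iso_D_iso A B (f : cmap A B) (g : cmap B A) :
  (forall i V s, g i V (f i V s) = s) -> (forall i V s, f i V (g i V s) = s) ->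
  D_iso A B.
Proof.
move=> gf fg; apply: homotopy_equivalent_D_iso; exists f, g.
by split; apply: homotopic_ext.
Qed.

Lemma quasi_iso_D_iso A B (f : cmap A B) : quasi_iso f -> D_iso A B.
Proof.
move=> qf; exists (DMap f), (DInv qf); split.
  exact: dmor_invl.
exact: dmor_invr.
Qed.

Lemma D_iso_sym A B : D_iso A B -> D_iso B A.
Proof. by move=> [f [g [gf fg]]]; exists g, f. Qed.

Lemma D_iso_trans A B C : D_iso A B -> D_iso B C -> D_iso A C.
Proof.
have cancel X Y Z (f : dmor X Y) (g : dmor Y X) (f' : dmor Y Z) (g' : dmor Z Y) :
    dmor_eq (DComp g f) (DId X) -> dmor_eq (DComp g' f') (DId Y) ->
    dmor_eq (DComp (DComp g g') (DComp f' f)) (DId X).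
  move=> gf gf'; apply: dmor_trans gf.
  apply: dmor_trans (dmor_sym (dmor_assoc _ _ _)) _; apply: dmor_comp; first exact: dmor_refl.
  apply: dmor_trans (dmor_assoc _ _ _) _; apply: dmor_trans (dmor_idl f).
  by apply: dmor_comp => //; exact: dmor_refl.
move=> [f [g [gf fg]]] [f' [g' [gf' fg']]]; exists (DComp f' f), (DComp g g').
by split; exact: cancel.
Qed.

(* [pull f u v] : the map v represents u o f up to homotopy.  For injective I it
   is the graph of f^* : [B, I] -> [A, I], which inverts quasi-isomorphisms and
   hence is well defined on morphisms of the derived category. *)
Fixpoint pull I A B (f : dmor A B) : cmap B I -> cmap A I -> Prop :=
  match f in dmor A B return cmap B I -> cmap A I -> Prop with
  | DMap A B a => fun u v => homotopic v (comp_cmap u a)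
  | DInv A B s _ => fun u v => homotopic (comp_cmap v s) u
  | DComp A B C g f => fun u v => exists w, pull g u w /\ pull f w v
  end.

Lemma pull_homotopic I A B (f : dmor A B) (u u' : cmap B I) v v' :
  homotopic u u' -> homotopic v v' -> pull f u v -> pull f u' v'.
Proof.
elim: f u u' v v' => [{}A {}B a|{}A {}B s qs|{}A {}B C g IHg f IHf] u u' v v' uu vv /=.
- move=> e; apply: homotopic_trans (homotopic_sym vv) _.
  by apply: homotopic_trans e _; exact: homotopic_compr.
- move=> e; apply: homotopic_trans (homotopic_compr _ (homotopic_sym vv)) _.
  exact: homotopic_trans e uu.
- move=> [w [gw fw]]; exists w; split; first exact: IHg uu (homotopic_refl _) gw.
  exact: IHf (homotopic_refl _) vv fw.
Qed.

Lemma pull_post I J (k : cmap I J) A B (f : dmor A B) (u : cmap B I) v :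
  pull f u v -> pull f (comp_cmap k u) (comp_cmap k v).
Proof.
elim: f u v => [{}A {}B a|{}A {}B s qs|{}A {}B C g IHg f IHf] u v /=.
- by move=> /(homotopic_compl k).
- by move=> /(homotopic_compl k).
- by move=> [w [gw fw]]; exists (comp_cmap k w); split; [exact: IHg|exact: IHf].
Qed.

Section PullInjective.
Context (I : complex R U).
Hypothesis injI : forall i, injective_sheaf (I i).

Lemma pull_total A B (f : dmor A B) (u : cmap B I) : exists v, pull f u v.
Proof.
elim: f u => [{}A {}B a|{}A {}B s qs|{}A {}B C g IHg f IHf] u /=.
- by exists (comp_cmap u a); exact: homotopic_refl.
- by have [v vP] := quasi_iso_lift qs injI u; exists v; exact: homotopic_sym.
- by have [w gw] := IHg u; have [v fw] := IHf w; exists v, w.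
Qed.

(** Each generating relation of the localization is checked on [pull]. For the two inverse
    relations, [quasi_iso_lift] supplies the intermediate map and [quasi_iso_inj] cancels a
    quasi-isomorphism. *)
Lemma pull_dmor_eq A B (f g : dmor A B) : dmor_eq f g ->
  forall (u : cmap B I) v, pull f u v <-> pull g u v.
Proof.
elim=> {A B f g} //=.
- by move=> A B f g _ IH u v; rewrite IH.
- by move=> A B f g h _ IH1 _ IH2 u v; rewrite IH1.
- move=> A B C g g' f f' _ IHg _ IHf u v.
  by split=> -[w [/IHg gw /IHf fw]]; exists w.
- move=> A B C E h g f u v; split.
    by move=> [w [hw [w' [gw fw]]]]; exists w'; split=> //; exists w.
  by move=> [w' [[w [hw gw]] fw]]; exists w; split=> //; exists w'.
- move=> A B f u v; split=> [[w [uw fw]]|fu].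
    apply: pull_homotopic (homotopic_refl _) fw.
    by apply: homotopic_trans uw _; exact: homotopic_ext.
  by exists u; split=> //; exact: homotopic_ext.
- move=> A B f u v; split=> [[w [fu vw]]|fu].
    apply: pull_homotopic (homotopic_refl _) _ fu; apply: homotopic_sym.
    by apply: homotopic_trans vw _; exact: homotopic_ext.
  by exists v; split=> //; exact: homotopic_ext.
- move=> A B C g f u v; split=> [e|[w [uw vw]]].
    exists (comp_cmap u g); split; first exact: homotopic_refl.
    by apply: homotopic_trans e _; exact: homotopic_ext.
  apply: homotopic_trans vw _; apply: homotopic_trans (homotopic_compr _ uw) _.
  exact: homotopic_ext.
- move=> A B f g fg u v; split=> e; apply: homotopic_trans e _;
    apply: homotopic_compl => //; exact: homotopic_sym.
- move=> A B s qs u v; split=> [[w [wu vw]]|e].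
    apply: homotopic_trans vw _; apply: homotopic_trans wu _; exact: homotopic_ext.
  have [w wP] := quasi_iso_lift qs injI u; exists w; split; first exact: homotopic_sym.
  apply: homotopic_trans e _; apply: homotopic_trans wP; exact: homotopic_ext.
- move=> A B s qs u v; split=> [[w [wu vw]]|e].
    apply: (quasi_iso_inj qs injI); apply: homotopic_trans vw _.
    apply: homotopic_trans wu _; exact: homotopic_ext.
  exists (comp_cmap u s); split; first exact: homotopic_refl.
  apply: homotopic_compr; apply: homotopic_trans e _; exact: homotopic_ext.
Qed.

End PullInjective.

(** A Yoneda argument: pulling back the identities of [J] and [I] represents [f] and [g] by maps of
    complexes, and [pull_dmor_eq] turns the two inverse relations into homotopies. *)
Lemma D_iso_injective I J : (forall i, injective_sheaf (I i)) ->
  (forall i, injective_sheaf (J i)) -> D_iso I J -> homotopy_equivalent I J.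
Proof.
move=> injI injJ [f [g [gf fg]]].
have [a fa] := pull_total injJ f (id_cmap J).
have [b gb] := pull_total injI g (id_cmap I).
exists a, b; split.
  have /(pull_dmor_eq injI gf) /= : pull (DComp g f) (id_cmap I) (comp_cmap b a).
    exists b; split=> //; apply: pull_homotopic (pull_post b fa).
      exact: homotopic_ext.
    exact: homotopic_refl.
  by move=> e; apply: homotopic_trans e _; exact: homotopic_ext.
have /(pull_dmor_eq injJ fg) /= : pull (DComp f g) (id_cmap J) (comp_cmap a b).
  exists a; split=> //; apply: pull_homotopic (pull_post a gb).
    exact: homotopic_ext.
  exact: homotopic_refl.
by move=> e; apply: homotopic_trans e _; exact: homotopic_ext.
Qed.

End Homotopy.

(** * Functors on complexes and the derived category *)

Section ComplexFunctor.
Context (R : realType) (T : topologicalType) (U U' : opens T).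
Context (F : complex R U -> complex R U').
Context (Fmap : forall A B, cmap A B -> cmap (F A) (F B)).
Hypothesis Fmap_id : forall A, homotopic (Fmap (id_cmap A)) (id_cmap (F A)).
Hypothesis Fmap_comp : forall A B C (g : cmap B C) (f : cmap A B),
  homotopic (Fmap (comp_cmap g f)) (comp_cmap (Fmap g) (Fmap f)).
Hypothesis Fmap_homotopic : forall A B (f g : cmap A B),
  homotopic f g -> homotopic (Fmap f) (Fmap g).

(** Separated from the case of derived isomorphisms for the sake of direct images, which preserve
    homotopies but in general not quasi-isomorphisms. *)
Lemma functor_homotopy_equivalent A B :
  homotopy_equivalent A B -> homotopy_equivalent (F A) (F B).
Proof.
move=> [f [g [gf fg]]]; exists (Fmap f), (Fmap g); split.
  apply: homotopic_trans (homotopic_sym (Fmap_comp _ _)) _.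
  exact: homotopic_trans (Fmap_homotopic gf) (Fmap_id _).
apply: homotopic_trans (homotopic_sym (Fmap_comp _ _)) _.
exact: homotopic_trans (Fmap_homotopic fg) (Fmap_id _).
Qed.

Hypothesis Fmap_quasi_iso : forall A B (s : cmap A B),
  quasi_iso s -> quasi_iso (Fmap s).

Fixpoint functor_dmor A B (f : dmor A B) : dmor (F A) (F B) :=
  match f in dmor A B return dmor (F A) (F B) with
  | DMap _ _ a => DMap (Fmap a)
  | DInv _ _ _ qs => DInv (Fmap_quasi_iso qs)
  | DComp _ _ _ g f => DComp (functor_dmor g) (functor_dmor f)
  end.

Lemma functor_dmor_id A : dmor_eq (DMap (Fmap (id_cmap A))) (DId (F A)).
Proof. exact: dmor_homotopic. Qed.

Lemma functor_dmor_eq A B (f g : dmor A B) :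
  dmor_eq f g -> dmor_eq (functor_dmor f) (functor_dmor g).
Proof.
elim=> {A B f g} /=.
- by move=> A B f; exact: dmor_refl.
- by move=> A B f g _; exact: dmor_sym.
- by move=> A B f g h _ IH1 _ IH2; exact: dmor_trans IH1 IH2.
- by move=> A B C g g' f f' _ IHg _ IHf; exact: dmor_comp.
- by move=> *; exact: dmor_assoc.
- move=> A B f; apply: dmor_trans (dmor_idl _).
  by apply: dmor_comp; [exact: functor_dmor_id|exact: dmor_refl].
- move=> A B f; apply: dmor_trans (dmor_idr _).
  by apply: dmor_comp; [exact: dmor_refl|exact: functor_dmor_id].
- by move=> A B C g f; apply: dmor_trans (dmor_homotopic (Fmap_comp g f)) (dmor_map_comp _ _).
- by move=> A B f g fg; apply: dmor_homotopic; exact: Fmap_homotopic.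
- move=> A B s qs; apply: dmor_trans (dmor_invl _) (dmor_sym (functor_dmor_id A)).
- move=> A B s qs; apply: dmor_trans (dmor_invr _) (dmor_sym (functor_dmor_id B)).
Qed.

Lemma functor_D_iso A B : D_iso A B -> D_iso (F A) (F B).
Proof.
move=> [f [g [gf fg]]]; exists (functor_dmor f), (functor_dmor g); split.
  exact: dmor_trans (functor_dmor_eq gf) (functor_dmor_id A).
exact: dmor_trans (functor_dmor_eq fg) (functor_dmor_id B).
Qed.

End ComplexFunctor.

Lemma res_square (R : realType) (T : topologicalType) (U : opens T) (F : sheaf R U)
    (V W W' Z : subopen U) (h : W `<=` V) (k : Z `<=` W) (h' : W' `<=` V)
    (k' : Z `<=` W') (s : F V) : res F k (res F h s) = res F k' (res F h' s).
Proof.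
have hk : Z `<=` V by move=> x /k /h.
by rewrite (res_comp h k hk) (res_comp h' k' hk).
Qed.

(** * Restriction to open subspaces *)

Section Restriction.
Context (R : realType) (T : topologicalType) (U U' : opens T) (h : U `<=` U').

Definition restrict_map (A B : complex R U') (f : cmap A B) :
  cmap (restrict h A) (restrict h B) :=
  @CMap _ _ _ (restrict h A) (restrict h B) (fun i => restrict_hom h (f i))
    (fun i V s => cmap_diff f (V := widen h V) s).

Lemma restrict_map_homotopic (A B : complex R U') (f g : cmap A B) :
  homotopic f g -> homotopic (restrict_map f) (restrict_map g).
Proof.
by move=> [k kP]; exists (fun i => restrict_hom h (k i)) => i V s; exact: kP.
Qed.

Lemma restrict_map_quasi_iso (A B : complex R U') (s : cmap A B) :
  quasi_iso s -> quasi_iso (restrict_map s).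
Proof.
move=> qs i x Ux; have [inj_s surj_s] := qs i x (h Ux).
pose up (C : complex R U') (c : cocycle (restrict h C) i x) : cocycle C i x :=
  @Cocycle _ _ _ C i x (widen h (cc_dom c)) (cc_mem c) (cc_sec c) (cc_diff c).
have trace_sub (W : subopen U') : widen h (trace U W) `<=` W by move=> y [].
split=> [a b [W [ha [hb [u [Wx e]]]]]|t].
  have [|Z [ka [kb [v [Zx e']]]]] := inj_s (up _ a) (up _ b).
    by exists (widen h W), ha, hb, u.
  have ZZ : trace U Z `<=` Z by move=> y [].
  exists (trace U Z), (subset_trans ZZ ka), (subset_trans ZZ kb),
    (res (A i) (trace_sub Z) v); split; first by split.
  rewrite /= hom_nat -e' linearB.
  by congr (_ - _); symmetry; exact: res_comp.
have [c [W [hc [ht [v [Wx e]]]]]] := surj_s (up _ t).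
have dc : diff (restrict h A) (i + 1) (trace U (cc_dom c))
    (res (A (i + 1)) (trace_sub (cc_dom c)) (cc_sec c)) = 0.
  by rewrite /= hom_nat cc_diff linear0.
have mc : subopen_set (trace U (cc_dom c)) x by split=> //; exact: cc_mem.
exists (Cocycle mc dc).
have hWc : trace U W `<=` trace U (cc_dom c) by move=> y [/hc Wy Uy].
have hWt : trace U W `<=` cc_dom t by move=> y [/ht].
exists (trace U W), hWc, hWt, (res (B i) (trace_sub W) v); split; first by split.
rewrite /= [RHS]hom_nat -e linearB hom_nat; congr (_ - _); last by symmetry; exact: res_comp.
have k : widen h (trace U W) `<=` cc_dom c by move=> y [/hc].
refine (etrans (res_comp _ _ k _) _); symmetry; exact: res_comp.
Qed.

Lemma restrict_D_iso (A B : complex R U') :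
  D_iso A B -> D_iso (restrict h A) (restrict h B).
Proof.
apply: (functor_D_iso (Fmap := restrict_map)).
- by move=> C; exact: homotopic_ext.
- by move=> C D E g f; exact: homotopic_ext.
- exact: restrict_map_homotopic.
- exact: restrict_map_quasi_iso.
Qed.

End Restriction.

Section RestrictComposite.
Context (R : realType) (T : topologicalType).

(** The two complexes are evaluated on opens with the same points but different inclusion proofs, so
    sections are compared by restriction along the identity inclusion. *)
Lemma restrict_restrict (U U' U'' : opens T) (h : U `<=` U') (h' : U' `<=` U'')
    (h'' : U `<=` U'') (A : complex R U'') :
  D_iso (restrict h (restrict h' A)) (restrict h'' A).
Proof.
have k (V : subopen U) : widen h'' V `<=` widen h' (widen h V) by [].
have k' (V : subopen U) : widen h' (widen h V) `<=` widen h'' V by [].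
have f_lin i V : linear (fun s : restrict h (restrict h' A) i V =>
    res (A i) (k V) s : restrict h'' A i V) by move=> a s t; rewrite linearP.
have g_lin i V : linear (fun s : restrict h'' A i V =>
    res (A i) (k' V) s : restrict h (restrict h' A) i V) by move=> a s t; rewrite linearP.
pose f i := @hom_of _ _ _ _ _ _ (f_lin i) (fun V W l s =>
  @res_square _ _ _ (A i) (widen h' (widen h V)) (widen h' (widen h W))
    (widen h'' V) (widen h'' W) l (k W) (k V) l s).
pose g i := @hom_of _ _ _ _ _ _ (g_lin i) (fun V W l s =>
  @res_square _ _ _ (A i) (widen h'' V) (widen h'' W)
    (widen h' (widen h V)) (widen h' (widen h W)) l (k' W) (k' V) l s).
have f_diff i V s : f (i + 1) V (diff _ i V s) = diff _ i V (f i V s).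
  by rewrite /= -hom_nat.
have g_diff i V s : g (i + 1) V (diff _ i V s) = diff _ i V (g i V s).
  by rewrite /= -hom_nat.
apply: (@iso_D_iso _ _ _ _ _ (CMap f_diff) (CMap g_diff)) => i V s /=.
  by rewrite (res_comp _ _ (@subset_refl _ _)) res_id.
by rewrite (res_comp _ _ (@subset_refl _ _)) res_id.
Qed.

Lemma restrict_self (U : opens T) (h : U `<=` U) (A : complex R U) :
  D_iso (restrict h A) A.
Proof.
have k (V : subopen U) : V `<=` widen h V by [].
have k' (V : subopen U) : widen h V `<=` V by [].
have f_lin i V : linear (fun s : restrict h A i V =>
    res (A i) (k V) s : A i V) by move=> a s t; rewrite linearP.
have g_lin i V : linear (fun s : A i V =>
    res (A i) (k' V) s : restrict h A i V) by move=> a s t; rewrite linearP.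
pose f i := @hom_of _ _ _ _ _ _ (f_lin i) (fun V W l s =>
  @res_square _ _ _ (A i) (widen h V) (widen h W) V W l (k W) (k V) l s).
pose g i := @hom_of _ _ _ _ _ _ (g_lin i) (fun V W l s =>
  @res_square _ _ _ (A i) V W (widen h V) (widen h W) l (k' W) (k' V) l s).
have f_diff i V s : f (i + 1) V (diff _ i V s) = diff _ i V (f i V s).
  by rewrite /= -hom_nat.
have g_diff i V s : g (i + 1) V (diff _ i V s) = diff _ i V (g i V s).
  by rewrite /= -hom_nat.
apply: (@iso_D_iso _ _ _ _ _ (CMap f_diff) (CMap g_diff)) => i V s /=.
  by rewrite (res_comp _ _ (@subset_refl _ _)) res_id.
by rewrite (res_comp _ _ (@subset_refl _ _)) res_id.
Qed.

End RestrictComposite.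

(** * Truncation and direct image *)

Section TruncationFunctor.
Context (R : realType) (T : topologicalType) (U : opens T) (j : int).
Implicit Types A B : complex R U.

Lemma trunc_map_cond A B (f : cmap A B) i (V : subopen U) (s : A i V) :
  trunc_cond j s -> trunc_cond j (f i V s).
Proof.
move=> [sd s0]; split=> ij; first by rewrite -cmap_diff sd // linear0.
by rewrite s0 // linear0.
Qed.

Definition trunc_condition A i : local_condition (A i) :=
  LocalCondition (@trunc_submodule R T U j A i) (@trunc_res R T U j A i)
    (@trunc_local R T U j A i).

Definition trunc_map_hom A B (f : cmap A B) i : hom (trunc j A i) (trunc j B i) :=
  @subhom _ _ _ _ _ (trunc_condition A i) (trunc_condition B i) (f i)
    (@trunc_map_cond A B f i).

Lemma trunc_map_diff A B (f : cmap A B) i V s :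
  trunc_map_hom f (i + 1) V (diff (trunc j A) i V s) =
  diff (trunc j B) i V (trunc_map_hom f i V s).
Proof. by apply: val_inj; exact: cmap_diff. Qed.

Definition trunc_map A B (f : cmap A B) : cmap (trunc j A) (trunc j B) :=
  CMap (trunc_map_diff f).

Lemma trunc_map_homotopic A B (f g : cmap A B) :
  homotopic f g -> homotopic (trunc_map f) (trunc_map g).
Proof.
move=> [k kP].
(* In degrees i >= j the homotopy starts in degree i + 1 > j, where the truncation is 0. *)
have k_cond i V (s : A (i + 1) V) : trunc_cond j s -> trunc_cond j (k i V s).
  by move=> [_ s0]; split=> ij; rewrite s0 ?linear0 //; lia.
exists (fun i => @subhom _ _ _ _ _ (trunc_condition A (i + 1)) (trunc_condition B i)
  (k i) (@k_cond i)) => i V s.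
by apply: val_inj; exact: kP.
Qed.

(** In degrees above j both truncations vanish. In a degree i + 1 <= j the truncation has the same
    cocycles as the complex, and it contains all of degree i, hence has the same coboundaries. *)
Lemma trunc_map_quasi_iso A B (s : cmap A B) : quasi_iso s -> quasi_iso (trunc_map s).
Proof.
move=> qs i x Ux; have [inj_s surj_s] := qs i x Ux.
have [le_ij|lt_ji] := leP (i + 1) j; last first.
  have sec0 (C : complex R U) (c : cocycle (trunc j C) i x) : cc_sec c = 0.
    by apply: val_inj; have [_ ->] := submoduleP (cc_sec c).
  have coh (C : complex R U) (c d : cocycle (trunc j C) i x) : cohomologous c d.
    exists (subopenI (cc_dom c) (cc_dom d)), (@subIsetl _ _ _), (@subIsetr _ _ _), 0.
    split; first by split; exact: cc_mem.
    by rewrite !sec0 !linear0 addr0.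
  split=> [a b _|t]; first exact: coh.
  have d0 : diff (trunc j A) (i + 1) (cc_dom t) 0 = 0 by rewrite linear0.
  by exists (Cocycle (cc_mem t) d0); exact: coh.
have cond_i (C : complex R U) V (u : C i V) : trunc_cond j u.
  by split=> ij; exfalso; move: le_ij; rewrite ?ij; lia.
pose up (C : complex R U) (c : cocycle (trunc j C) i x) : cocycle C i x :=
  Cocycle (cc_mem c) (congr1 val (cc_diff c)).
split=> [a b [W [ha [hb [u [Wx e]]]]]|t].
  have [|Z [ka [kb [v [Zx e']]]]] := inj_s (up _ a) (up _ b).
    by exists W, ha, hb, (val u); split=> //; rewrite -[RHS]/(val (diff (trunc j B) i W u)) -e.
  exists Z, ka, kb, (to_submodule (trunc_submodule j A i Z) (cond_i A Z v)).
  by split=> //; apply: val_inj.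
have [c [W [hc [ht [v [Wx e]]]]]] := surj_s (up _ t).
have cond_c : trunc_cond j (cc_sec c).
  by split=> [_|]; [exact: cc_diff|rewrite ltNge le_ij].
have dc : diff (trunc j A) (i + 1) (cc_dom c)
    (to_submodule (trunc_submodule j A (i + 1) (cc_dom c)) cond_c) = 0.
  by apply: val_inj; exact: cc_diff.
exists (Cocycle (cc_mem c) dc), W, hc, ht,
  (to_submodule (trunc_submodule j B i W) (cond_i B W v)).
by split=> //; apply: val_inj.
Qed.

Lemma trunc_D_iso A B : D_iso A B -> D_iso (trunc j A) (trunc j B).
Proof.
apply: (functor_D_iso (Fmap := trunc_map)).
- by move=> C; apply: homotopic_ext => i V s; apply: val_inj.
- by move=> C D E g f; apply: homotopic_ext => i V s; apply: val_inj.
- exact: trunc_map_homotopic.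
- exact: trunc_map_quasi_iso.
Qed.

End TruncationFunctor.

Section TruncationPush.
Context (R : realType) (T : topologicalType).

Lemma trunc_above (U : opens T) (j : int) (A : complex R U) :
  (forall i, j < i -> is_zero_sheaf (A i)) -> D_iso (trunc j A) A.
Proof.
move=> A0.
have condA i V (s : A i V) : trunc_cond j s.
  by split=> ij; apply: A0; rewrite ?ij ?ltzD1.
have f_lin i V : linear (fun s : trunc j A i V => val s : A i V) by [].
have g_lin i V : linear (fun s : A i V =>
    to_submodule (trunc_submodule j A i V) (condA i V s) : trunc j A i V).
  by move=> a s t; apply: val_inj.
pose f i := @hom_of _ _ _ (trunc j A i) (A i) _ (f_lin i) (fun V W l s => erefl).
have g_nat i (V W : subopen U) (l : W `<=` V) (s : A i V) :
    to_submodule (trunc_submodule j A i W) (condA i W (res _ l s)) =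
    res (trunc j A i) l (to_submodule (trunc_submodule j A i V) (condA i V s)).
  exact: val_inj.
pose g i := @hom_of _ _ _ (A i) (trunc j A i) _ (g_lin i) (g_nat i).
have f_diff i V s : f (i + 1) V (diff _ i V s) = diff _ i V (f i V s) by [].
have g_diff i V s : g (i + 1) V (diff _ i V s) = diff _ i V (g i V s).
  exact: val_inj.
apply: (@iso_D_iso _ _ _ _ _ (CMap f_diff) (CMap g_diff)) => i V s //.
exact: val_inj.
Qed.

Section Push.
Context (U U' : opens T) (h : U `<=` U').

(** An open subset of [U] is its own trace on [U], so restriction to [U] undoes the underived direct
    image. *)
Lemma restrict_trunc_push (j : int) (A : complex R U) :
  D_iso (restrict h (trunc j (push U' A))) (trunc j A).
Proof.
pose tr (V : subopen U) := trace U (widen h V).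
have k (V : subopen U) : V `<=` tr V by move=> x Vx; split=> //; exact: subopen_sub Vx.
have k' (V : subopen U) : tr V `<=` V by move=> x [].
have f_cond i V (s : restrict h (trunc j (push U' A)) i V) :
    trunc_cond j (res (A i) (k V) (val s)).
  exact: (@trunc_res R T U j A i (tr V) V (k V) (val s) (submoduleP s)).
have g_cond i V (s : trunc j A i V) :
    @trunc_cond R T U' j (push U' A) i (widen h V) (res (A i) (k' V) (val s)).
  exact: (@trunc_res R T U j A i V (tr V) (k' V) (val s) (submoduleP s)).
pose f_fun i V (s : restrict h (trunc j (push U' A)) i V) : trunc j A i V :=
  to_submodule (trunc_submodule j A i V) (f_cond i V s).
pose g_fun i V (s : trunc j A i V) : restrict h (trunc j (push U' A)) i V :=
  to_submodule (trunc_submodule j (push U' A) i (widen h V)) (g_cond i V s).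
have f_lin i V : linear (@f_fun i V).
  by move=> a s t; apply: val_inj; rewrite /= linearP.
have g_lin i V : linear (@g_fun i V).
  by move=> a s t; apply: val_inj; rewrite /= linearP.
have f_nat i (V W : subopen U) (l : W `<=` V) s :
    @f_fun i W (res _ l s) = res _ l (@f_fun i V s).
  apply: val_inj; exact: (@res_square _ _ _ (A i) (tr V) (tr W) V W _ (k W) (k V) l).
have g_nat i (V W : subopen U) (l : W `<=` V) s :
    @g_fun i W (res _ l s) = res _ l (@g_fun i V s).
  apply: val_inj; exact: (@res_square _ _ _ (A i) V W (tr V) (tr W) l (k' W) (k' V)).
pose f i := @hom_of _ _ _ _ _ _ (f_lin i) (f_nat i).
pose g i := @hom_of _ _ _ _ _ _ (g_lin i) (g_nat i).
have f_diff i V s : f (i + 1) V (diff _ i V s) = diff _ i V (f i V s).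
  by apply: val_inj; rewrite /= -hom_nat.
have g_diff i V s : g (i + 1) V (diff _ i V s) = diff _ i V (g i V s).
  by apply: val_inj; rewrite /= -hom_nat.
apply: (@iso_D_iso _ _ _ _ _ (CMap f_diff) (CMap g_diff)) => i V s; apply: val_inj => /=.
  by rewrite (res_comp _ _ (@subset_refl _ _)) res_id.
by rewrite (res_comp _ _ (@subset_refl _ _)) res_id.
Qed.

Definition push_map (A B : complex R U) (f : cmap A B) :
  cmap (push U' A) (push U' B) :=
  @CMap _ _ _ (push U' A) (push U' B) (fun i => push_hom U' (f i))
    (fun i V s => cmap_diff f (V := trace U V) s).

Lemma push_map_homotopic (A B : complex R U) (f g : cmap A B) :
  homotopic f g -> homotopic (push_map f) (push_map g).
Proof.
by move=> [k kP]; exists (fun i => push_hom U' (k i)) => i V s; exact: kP.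
Qed.

Hypothesis enough : forall A : complex R U, exists I, injective_resolution A I.

Lemma resolve_injective_resolution (A : complex R U) : injective_resolution A (resolve A).
Proof.
rewrite /resolve; case: pselect => [e|ne]; last by case: (ne (enough A)).
by case: cid.
Qed.

Lemma resolve_D_iso (A : complex R U) : D_iso (resolve A) A.
Proof.
have [[r qr] _] := resolve_injective_resolution A.
exact: D_iso_sym (quasi_iso_D_iso qr).
Qed.

Lemma Rpush_D_iso (A B : complex R U) : D_iso A B -> D_iso (Rpush h A) (Rpush h B).
Proof.
move=> AB; have [_ injA] := resolve_injective_resolution A.
have [_ injB] := resolve_injective_resolution B.
apply: homotopy_equivalent_D_iso.
apply: (functor_homotopy_equivalent (Fmap := push_map)).
- by move=> C; exact: homotopic_ext.
- by move=> C D E g f; exact: homotopic_ext.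
- exact: push_map_homotopic.
apply: D_iso_injective injA injB _.
by apply: D_iso_trans (resolve_D_iso A) (D_iso_trans AB (D_iso_sym (resolve_D_iso B))).
Qed.

End Push.
End TruncationPush.

(** * Smallest neighbourhoods and enough injectives *)

Section Alexandrov.
Context (R : realType) (T : choiceType) (K : scomplex T).

(** If [c] lies in the star of u and t is a face of u, then u belongs to the smallest element [x] of
    [c], so t is a face of the largest simplex [s] of [x], and fst(s) is contained in fst(t). *)
Lemma Sd2_max (c : fst_space K) : exists2 s, simplices K s &
  points K (fstar K s) c /\
  forall V : set (fst_space K), open V -> V c -> points K (fstar K s) `<=` V.
Proof.
have Xc : simplices (Sd (Sd K)) (val c) by have := valP c; rewrite inE.
have [x xc xmin] := Sd2_min Xc.
have [_ /(_ _ xc)[x0 xK xx] _] := Xc; have /fset0Pn[s0 s0x] := x0.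
have [s sx smax] : exists2 s, s \in x & forall t, t \in x -> (t `<=` s)%fset.
  have [[s sx] _ smax] := @arg_maxnP _ [` s0x]%fset predT (fun y => #|` val y|) isT.
  exists s => // t tx; case/orP: (xx _ _ tx sx) => // st.
  have ts : (#|` t| <= #|` s|)%N := smax [` tx]%fset isT.
  by have /eqP <- : s == t by rewrite eqEfcard st.
exists s; first exact: xK.
have Ks := xK _ sx; split.
  exists s; first by split=> //; exact: fsubset_refl.
  by apply/lstarP => // y /xmin /fsubsetP; apply.
move=> V /fst_openP[S SK <-] [t St [u [Ku tu] cu]] d [v [Kv sv] dv].
exists t => //; exists v => //; split=> //.
apply: fsubset_trans tu _; apply: fsubset_trans sv; apply: smax.
exact: (lstarP Ku Xc).1 cu _ xc.
Qed.

Lemma enough_injectives (U : opens (fst_space K)) (A : complex R U) :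
  exists I, injective_resolution A I.
Proof.
pose s c := s2val (cid2 (Sd2_max c)).
have sP c := s2valP' (cid2 (Sd2_max c)).
have Ks c := s2valP (cid2 (Sd2_max c)).
have open_s c : open (points K (fstar K (s c))).
  apply/fst_openP; exists [set s c]; first by move=> _ ->; exact: Ks.
  exact: bigcup_set1.
have open_N c : open (points K (fstar K (s c)) `&` U).
  by apply: openI => //; exact: opens_open.
(* The intersection with [U] makes this an open subset of [U] for every [c]; for [c] in [U] it
   changes nothing. *)
pose N c : subopen U := SubOpen (open_N c) (@subIsetr _ _ _).
have N_mem (c : fst_space K) : opens_set U c -> subopen_set (N c) c.
  by move=> Uc; split=> //; exact: (sP c).1.
have N_min (V : subopen U) c : subopen_set V c -> N c `<=` V.
  move=> Vc; apply: subset_trans (@subIsetl _ _ _) _.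
  by apply: (sP c).2 => //; exact: subopen_open.
exact: (bar_injective_resolution A N_mem N_min).
Qed.

End Alexandrov.

(** * The Deligne complex *)

Section DeligneComplex.
Context (R : realType) (T : choiceType) (K : scomplex T) (n : nat).
Context (X : filtration K n) (p : nat -> int).
Hypothesis hp : GM_perversity p.

(** For m > 0 the complex is truncated at p(m + 1) <= p(m + 2), and for m = 0 it sits in degree 0 =
    p(2). The bound p(m + 2) is the degree of the next truncation. *)
Lemma deligne_rec_above m i : p m.+2 < i -> is_zero_sheaf (deligne_rec R X p m i).
Proof.
case: m => [|m] lt_pi V s.
  move: s; rewrite /= /constant_ob; have [p2 _] := hp.
  by rewrite gt_eqF -?p2 // => s; exact: zero_subsheaf_zero.
apply: val_inj; have [_ ->] := submoduleP s; first by [].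
by apply: le_lt_trans lt_pi; case: hp => _ /(_ m.+2 isT) /andP[].
Qed.

Lemma deligne_rec_restrict m :
  D_iso (restrict (@Udelta_le _ _ _ X m.+2) (deligne_rec R X p m.+1))
    (deligne_rec R X p m).
Proof.
apply: D_iso_trans (restrict_trunc_push _ _ _) _.
apply: D_iso_trans (trunc_D_iso _ (resolve_D_iso (@enough_injectives _ _ _ _) _)) _.
exact/trunc_above/deligne_rec_above.
Qed.

Context (F : complex R (full_opens (fst_space K))).

Lemma deligne_axioms_rec : deligne_axioms X p F ->
  forall m, (m <= n.-1)%N -> D_iso (restrictU X m.+2 F) (deligne_rec R X p m).
Proof.
move=> [AX1 AX2]; elim=> [//|m IH] lt_mn.
apply: D_iso_trans (AX2 m.+2 _) _; first by move: lt_mn; case: (n).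
apply: trunc_D_iso; apply: Rpush_D_iso; first exact: enough_injectives.
by apply: IH; exact: ltnW.
Qed.

Lemma rec_deligne_axioms :
  (forall m, (m <= n.-1)%N -> D_iso (restrictU X m.+2 F) (deligne_rec R X p m)) ->
  deligne_axioms X p F.
Proof.
move=> FD; split=> [|[|[|m]] // /andP[_ lt_mn]]; first exact: (FD 0%N).
have lt_mn' : (m < n.-1)%N by move: lt_mn; case: (n).
apply: D_iso_trans (FD m.+1 lt_mn') _.
apply: trunc_D_iso; apply: Rpush_D_iso; first exact: enough_injectives.
by apply: D_iso_sym; apply: FD; exact: ltnW.
Qed.

(** [U_(n+1)] and the whole space have the same points, so restricting one way and back is the
    identity up to isomorphism. For n = 0 the index [n.-1.+2] is 2, and U_2 is already
    everything. *)
Lemma rec_deligne_complex :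
  D_iso (restrictU X n.-1.+2 F) (deligne_rec R X p n.-1) <->
  D_iso F (deligne_complex R X p).
Proof.
split=> FD.
  apply: D_iso_trans (restrict_D_iso (deligne_top X) FD).
  apply: D_iso_sym; apply: D_iso_trans (restrict_restrict _ _ (@subset_refl _ _) _) _.
  exact: restrict_self.
apply: D_iso_trans (restrict_D_iso _ FD) _.
apply: D_iso_trans (restrict_restrict _ _ (@subset_refl _ _) _) _.
exact: restrict_self.
Qed.

(** Descending induction on m: an isomorphism on U_(m+3) restricts to U_(m+2), where
    [deligne_rec_restrict] identifies its target with the previous stage. *)
Lemma deligne_rec_descend :
  D_iso (restrictU X n.-1.+2 F) (deligne_rec R X p n.-1) ->
  forall m, (m <= n.-1)%N -> D_iso (restrictU X m.+2 F) (deligne_rec R X p m).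
Proof.
move=> top m; move: (n.-1) top => N top le_mN.
rewrite -(subKn le_mN); elim: (N - m)%N (leq_subr m N) => [|k IH] le_kN.
  by rewrite [(N - 0)%N]subn0.
have {}IH := IH (ltnW le_kN).
have e : (N - k)%N = (N - k.+1).+1 by rewrite subnSK.
rewrite e in IH.
move: (N - k.+1)%N IH => l IH.
apply: D_iso_trans _ (deligne_rec_restrict l).
apply: D_iso_trans _ (restrict_D_iso (@Udelta_le _ _ _ X l.+2) IH).
apply: D_iso_sym; exact: restrict_restrict.
Qed.

End DeligneComplex.

Theorem proposition1p0p2 (R : realType) (T : choiceType) (X' : scomplex T)
    (n : nat) (Xs : filtration X' n) (p : nat -> int)
    (hX : PL_pseudomanifold n%:Z (fun j => realization R (skel Xs j)))
    (hp : GM_perversity p)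
    (F : complex R (full_opens (fst_space X'))) :
  deligne_axioms Xs p F <-> D_iso F (deligne_complex R Xs p).
Proof.
split=> [/deligne_axioms_rec/(_ _ (leqnn _))/rec_deligne_complex //|].
move=> /rec_deligne_complex/(deligne_rec_descend hp); exact: rec_deligne_axioms.
Qed.
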